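(* Every graphing is a full subgraphing of a compact graphing.
   Context: Fix a positive integer $D$; all graphs have all degrees at most $D$. A graphing $\mathbf{G}=(I,\mathcal{A},E,\lambda)$ is a simple graph on node set $I$, where $(I,\mathcal{A})$ is a standard Borel space, $\lambda$ is a probability measure on $(I,\mathcal{A})$, every node has degree at most $D$, the edge set $E\subseteq I\times I$ is a Borel set avoiding the diagonal and invariant under interchanging coordinates, and for all $A,B\in\mathcal{A}$ we have $\int_A \deg_B(x)\,d\lambda(x)=\int_B\deg_A(x)\,d\lambda(x)$, where $\deg_B(x)$ is the number of edges from $x$ to points of $B$. When $I$ carries a metric $d$ whose Borel sets form $\mathcal{A}$, we write $\mathbf{G}=(I,d,E,\lambda)$. For $x\in I$ and integer $r\ge0$, $B(x,r)$ is the subgraph induced by the nodes at graph distance at most $r$ from $x$. An $r$-neighborhood isomorphism between $x$ and $y$ is a graph isomorphism $\phi:B(x,r)\to B(y,r)$ with $\phi(x)=y$; for such $\phi$, $d(\phi)=\max_{z\in B(x,r)} d(z,\phi(z))$. A graphing $\mathbf{G}=(I,d,E,\lambda)$ is compact if (C1) $(I,d)$ is a compact metric space; (C2) $E$ is a closed subset of $I\times I$; (C3) for every real $\varepsilon>0$ and integer $r\ge0$ there is $\delta>0$ such that for all $x,y\in I$ with $d(x,y)\le\delta$ there exists an $r$-neighborhood isomorphism $\phi$ between $x$ and $y$ with $d(\phi)\le\varepsilon$. A graphing $\mathbf{G}=(I,\mathcal{A},E,\lambda)$ is a full subgraphing of a graphing $\mathbf{G}'=(I',\mathcal{A}',E',\lambda')$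 if $\mathbf{G}$ is a union of connected components of $\mathbf{G}'$, $I$ is a Borel subset of $I'$, $\mathcal{A}=\mathcal{A}'|_I$, and $\lambda'(X)=\lambda(I\cap X)$ for every Borel $X\subseteq I'$. *)

(* Defs.v *)
From HB Require Import structures.
From mathcomp Require Import all_boot all_order all_algebra finmap.
From mathcomp Require Import all_classical all_reals all_analysis.

Set Implicit Arguments.
Unset Strict Implicit.
Unset Printing Implicit Defensive.

Import Order.TTheory GRing.Theory Num.Theory.

Local Open Scope classical_set_scope.
Local Open Scope ring_scope.

(* The common part of [Measurable] and [Metric], declared so that
   Hierarchy-Builder can join them. *)
#[short(type="pointedMetricType")]
HB.structure Definition PointedMetric (K : numDomainType) :=
  {T of Metric K T & isPointed T}.

(* Measurable and metric structures on one carrier; that the sigma-algebra is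
   the Borel one is a separate hypothesis, [borel_metric]. *)
#[short(type="measurableMetricType")]
HB.structure Definition MeasurableMetric d (K : numDomainType) :=
  {T of Measurable d T & Metric K T}.

Definition borel (X : topologicalType) : set (set X) := <<s @open X >>.

Definition borel_metric (R : realType) (d : measure_display)
    (T : measurableMetricType d R) : Prop :=
  @measurable d T = @borel T.

Definition complete_metric (R : realType) (X : metricType R) : Prop :=
  forall F : set_system X, ProperFilter F -> cauchy F -> exists l : X, F --> l.

Definition separable (X : topologicalType) : Prop :=
  exists2 S : set X, countable S & dense S.

(* The Polish space is allowed to live on another carrier [X], through a
   bijection [f] identifying the sigma-algebra of [T] with the Borel sets. *)
Definition standard_borel (R : realType) (d : measure_display)
    (T : measurableType d) : Prop :=
  exists X : metricType R,
    [/\ complete_metric X, separable X &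
        exists2 f : T -> X, bijective f &
          forall A : set T, measurable A <-> borel (f @` A)].

(* [\bar R]-valued; equal to [+oo] when there are infinitely many edges. *)
Definition deg (R : realType) (T : choiceType) (E : set (T * T)) (B : set T)
    (x : T) : \bar R :=
  counting [set y | B y /\ E (x, y)].

Record graphing (R : realType) (D : nat) (d : measure_display)
    (T : measurableType d) := Graphing {
  edges : set (T * T);
  gmeas : probability T R;
  graphing_standard : standard_borel R T;
  edges_measurable : measurable edges;
  edges_irrefl : forall x, ~ edges (x, x);
  edges_sym : forall x y, edges (x, y) -> edges (y, x);
  deg_le : forall x, (deg R edges setT x <= D%:R%:E)%E;
  deg_balanced : forall A B : set T, measurable A -> measurable B ->
    (\int[gmeas]_(x in A) deg R edges B x =
     \int[gmeas]_(x in B) deg R edges A x)%E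
}.

Fixpoint walk (T : Type) (E : set (T * T)) (n : nat) (x y : T) : Prop :=
  if n is m.+1 then exists2 z, E (x, z) & walk E m z y else x = y.

Definition gball (T : Type) (E : set (T * T)) (x : T) (r : nat) : set T :=
  [set y | exists2 n, (n <= r)%N & walk E n x y].

Definition component (T : Type) (E : set (T * T)) (x : T) : set T :=
  [set y | exists n, walk E n x y].

(* [phi] is a total function, but only its restriction to [gball E x r]
   matters. *)
Definition nbhd_iso (T : Type) (E : set (T * T)) (r : nat) (x y : T)
    (phi : T -> T) : Prop :=
  [/\ set_bij (gball E x r) (gball E y r) phi,
      forall u v, gball E x r u -> gball E x r v ->
        (E (u, v) <-> E (phi u, phi v)) &
      phi x = y].

(* [fset_set] is meaningful on finite sets only: balls of a graphing are finite
   since degrees are bounded. *)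
Definition iso_dist (R : realType) (T : metricType R) (E : set (T * T))
    (r : nat) (x : T) (phi : T -> T) : R :=
  \big[Num.max/0]_(z <- fset_set (gball E x r)) mdist z (phi z).

Definition compact_graphing (R : realType) (D : nat) (d : measure_display)
    (T : measurableMetricType d R) (G : graphing R D T) : Prop :=
  [/\ borel_metric T,
      compact [set: T],
      closed (edges G) &
      forall (eps : R) (r : nat), 0 < eps ->
        exists2 delta : R, 0 < delta &
          forall x y : T, mdist x y <= delta ->
            exists2 phi : T -> T, nbhd_iso (edges G) r x y phi &
              iso_dist (edges G) r x phi <= eps].

(* The inclusion of the node set of [G] in that of [G'] is rendered by an
   injection [f], so that [range f] stands for the node set of [G]. *)
Definition full_subgraphing (R : realType) (D : nat)
    (d d' : measure_display) (T : measurableType d) (T' : measurableType d')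
    (G : graphing R D T) (G' : graphing R D T') : Prop :=
  exists f : T -> T', injective f /\
    [/\ exists S : set T', range f = \bigcup_(x in S) component (edges G') x,
        forall x y, edges G (x, y) <-> edges G' (f x, f y),
        measurable (range f),
        forall A : set T, measurable A <->
          exists2 B : set T', measurable B & A = f @^-1` B &
        forall X : set T', measurable X -> gmeas G' X = gmeas G (f @^-1` X)].

(* Main.v *)
(** Lusin-Novikov for bounded sections makes [neighbors E A] measurable for
measurable [A], so greedy colorings show that points at bounded distance are
separated by finitely many measurable sets. Close countably many measurable
sets under Boolean operations and [neighbors E], starting from sets that code
the points of [T] and from these colors, and let [F x] be the 0-1 sequence of
memberships of [x]. Then [F] is injective and
- (lifting) a long common prefix of [F x] and [F x'] matches every neighbor of
  [x] with a neighbor of [x'] having a prescribed common prefix;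
- (separating) points at distance at most [r] with a common prefix of a length
  depending only on [r] are equal.
Both properties pass to the closure of the range of [F] in the Cantor space,
the edges being the closure of the edges of [G], and together they give (C3):
the isomorphism sends [u] to the unique point near [u] in the other ball. The
range is Borel since the decoding map [g'] is measurable: it consists of the
[z] such that [F (g' z) = z]. *)

Require Import Defs.
From HB Require Import structures.
From mathcomp Require Import all_boot all_order all_algebra finmap.
From mathcomp Require Import all_classical all_reals all_analysis.
From mathcomp Require Import measurable_realfun.

Set Implicit Arguments.
Unset Strict Implicit.
Unset Printing Implicit Defensive.

Import Order.TTheory GRing.Theory Num.Theory.

Local Open Scope classical_set_scope.
Local Open Scope ring_scope.

(** * Sequences and measurable predicates *)

Lemma dependent_choice_seq (L : Type) (P : seq L -> Prop) (s0 : seq L) :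
  P s0 -> (forall s, P s -> exists a, P (rcons s a)) ->
  exists w : nat -> L, forall n, P (s0 ++ mkseq w n).
Proof.
move=> P0 PS; have [a0 _] := PS _ P0.
have /choice[f fP] : forall s, exists a, P s -> P (rcons s a).
  move=> s; have [/PS[a ?]|nPs] := pselect (P s); first by exists a.
  by exists a0.
pose st n := iter n (fun s => rcons s (f s)) s0.
exists (f \o st) => n.
suff -> : s0 ++ mkseq (f \o st) n = st n.
  by elim: n => //= n; exact: fP.
elim: n => [|n IH]; first by rewrite cats0.
by rewrite mkseqS -rcons_cat IH.
Qed.

(** Call a node good if it has descendants at every depth. A good node has a good child: otherwise
    the descendants of each child stop at some depth [M a], and the maximum over the finitely many
    children bounds the depth below the node. *)
Lemma konig (L : eqType) (P : seq L -> Prop) :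
  (forall s t, P (s ++ t) -> P s) ->
  (forall s, exists l : seq L, forall a, P (rcons s a) -> a \in l) ->
  (forall n, exists2 s, size s = n & P s) ->
  exists w, forall n, P (mkseq w n).
Proof.
move=> Ppre Pfin Pinf.
pose good s := forall m, exists2 t, size t = m & P (s ++ t).
have [|s gs|w wP] := @dependent_choice_seq L good [::].
- by move=> m; have [s sm Ps] := Pinf m; exists s.
- apply: contrapT => /forallNP nex.
  have /choice[M MP] : forall a, exists m, forall t,
      size t = m -> ~ P (rcons s a ++ t).
    move=> a; have /existsNP[m mP] := nex a.
    by exists m => t tm Pt; apply: mP; exists t.
  have [l lP] := Pfin s.
  have [[|a t]// [tm] Pt] := gs (\max_(a <- l) M a).+1.
  rewrite -cat_rcons in Pt.
  have al := lP _ (Ppre _ _ Pt).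
  apply: (MP a (take (M a) t)).
    rewrite size_takel// tm.
    by rewrite (perm_big _ (perm_to_rem al)) big_cons leq_maxl.
  by apply: (Ppre _ (drop (M a) t)); rewrite -catA cat_take_drop.
- by exists w => n; have [[|//] _] := wP n 0%N; rewrite cats0.
Qed.

Definition agree (A : Type) (n : nat) (z z' : nat -> A) :=
  forall i, (i < n)%N -> z i = z' i.

Lemma agree_sym A n (z z' : nat -> A) : agree n z z' -> agree n z' z.
Proof. by move=> zz' i /zz'. Qed.

Lemma agree_trans A n (y x z : nat -> A) :
  agree n x y -> agree n y z -> agree n x z.
Proof. by move=> xy yz i ilt; rewrite xy// yz. Qed.

Lemma agreeW A m n (x z : nat -> A) : (m <= n)%N -> agree n x z -> agree m x z.
Proof. by move=> mn xz i im; apply: xz; exact: leq_trans mn. Qed.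

Lemma mkseq_agree A n (z z' : nat -> A) : mkseq z n = mkseq z' n <-> agree n z z'.
Proof.
split=> [e i ilt|zz'].
  by have := congr1 (fun s => nth (z i) s i) e; rewrite !nth_mkseq.
by apply/eq_in_map => i; rewrite mem_iota => /andP[_]; exact: zz'.
Qed.

(** Closedness in the product topology with discrete alphabets, in terms of prefixes. *)
Definition seq_closed (A B : Type) (F : (nat -> A) -> (nat -> B) -> Prop) :=
  forall z w, (forall n, exists z' w',
    [/\ agree n z z', agree n w w' & F z' w']) -> F z w.

Section measurable_prop.
Context d (T : measurableType d).
Implicit Types P Q : T -> Prop.

Lemma measurable_prop_cst (P : Prop) : measurable [set _ : T | P].
Proof.
have [p|np] := pselect P.
  by rewrite (_ : [set _ | _] = setT)//; apply/seteqP; split.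
by rewrite (_ : [set _ | _] = set0)//; apply/seteqP; split.
Qed.

Lemma measurable_prop_not P :
  measurable [set x | P x] -> measurable [set x | ~ P x].
Proof. by move=> mP; exact: (measurableC mP). Qed.

Lemma measurable_prop_and P Q : measurable [set x | P x] ->
  measurable [set x | Q x] -> measurable [set x | P x /\ Q x].
Proof. by move=> mP mQ; exact: (measurableI _ _ mP mQ). Qed.

Lemma measurable_prop_or P Q : measurable [set x | P x] ->
  measurable [set x | Q x] -> measurable [set x | P x \/ Q x].
Proof. by move=> mP mQ; exact: (measurableU _ _ mP mQ). Qed.

Lemma measurable_prop_exists (I : countType) (P : I -> T -> Prop) :
  (forall i, measurable [set x | P i x]) ->
  measurable [set x | exists i, P i x].
Proof.
move=> mP; rewrite (_ : [set x | _] = \bigcup_i [set x | P i x]).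
  by apply: countable_bigcupT_measurable => //; exact: countableP.
by apply/seteqP; split=> [x [i Pi]|x [i _ Pi]]; exists i.
Qed.

Lemma measurable_prop_forall (I : countType) (P : I -> T -> Prop) :
  (forall i, measurable [set x | P i x]) ->
  measurable [set x | forall i, P i x].
Proof.
move=> mP; rewrite (_ : [set x | _] = [set x | ~ exists i, ~ P i x]).
  apply: measurable_prop_not; apply: measurable_prop_exists => i.
  exact: measurable_prop_not.
apply/seteqP; split=> [x Px [i]|x nx i]; first exact.
by apply: contrapT => nP; apply: nx; exists i.
Qed.

Lemma measurable_prop_imply (P : Prop) Q : (P -> measurable [set x | Q x]) ->
  measurable [set x | P -> Q x].
Proof.
move=> mQ; have [p|np] := pselect P.
  by rewrite (_ : [set x | _] = [set x | Q x]); [exact: mQ|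
    apply/seteqP; split=> x /=; auto].
rewrite (_ : [set x | _] = setT)//.
by apply/seteqP; split=> // x _ /np.
Qed.

End measurable_prop.

(** For a countable alphabet these sets generate the Borel sigma-algebra of the product of discrete
    spaces. *)
Definition cylinders (A : Type) : set (set (nat -> A)) :=
  [set S | exists n a, S = [set z | z n = a]].

Definition cantor_seq := g_sigma_algebraType (@cylinders bool).

Lemma measurable_coord (n : nat) (a : bool) :
  measurable [set z : cantor_seq | z n = a].
Proof. by apply: sub_sigma_algebra; exists n, a. Qed.

Lemma measurable_mkseq (n : nat) (q : seq bool) :
  measurable [set z : cantor_seq | mkseq z n = q].
Proof.
rewrite (_ : [set z | _] = [set z : cantor_seq |
    size q = n /\ forall i, (i < n)%N -> z i = nth false q i]).
  apply: measurable_prop_and; first exact: measurable_prop_cst.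
  apply: measurable_prop_forall => i; apply: measurable_prop_imply => _.
  exact: measurable_coord.
apply/seteqP; split=> z /=.
  by move=> <-; split=> [|i ilt]; rewrite ?size_mkseq// nth_mkseq.
move=> [sq zq]; apply: (@eq_from_nth _ false) => [|i]; rewrite size_mkseq//.
by move=> ilt; rewrite nth_mkseq// zq.
Qed.

Lemma measurable_agree (n : nat) (S : set cantor_seq) :
  (forall z z', agree n z z' -> S z -> S z') -> measurable S.
Proof.
move=> Sn; rewrite (_ : S = [set z | exists q : seq bool,
    (exists2 z', S z' & mkseq z' n = q) /\ mkseq z n = q]).
  apply: measurable_prop_exists => q; apply: measurable_prop_and.
    exact: measurable_prop_cst.
  exact: measurable_mkseq.
apply/seteqP; split=> [z Sz|z [q [[z' Sz' <-]]]].
  by exists (mkseq z n); split=> //; exists z.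
by move/esym/mkseq_agree => /Sn; exact.
Qed.

(** * Projections of closed sets with bounded sections *)

Section bounded_sections.
Variables (L : countType) (D : nat).
Variable F : cantor_seq -> (nat -> L) -> Prop.
Hypothesis F_closed : seq_closed F.
Hypothesis F_bounded :
  forall x (w : 'I_D.+1 -> nat -> L), (forall i, F x (w i)) -> ~ injective w.

(** Only known to be analytic, as a projection of a closed set. *)
Let A (s : seq L) : set cantor_seq :=
  [set x | exists2 w, F x w & mkseq w (size s) = s].

(** The saturation of [A s] under agreement on [size s] bits: a superset that depends on finitely
    many bits. Along a branch [w] these sets shrink to the points with [F x w]. *)
Let O (s : seq L) : set cantor_seq :=
  [set x | exists x' w', [/\ F x' w', agree (size s) x x' &
                             mkseq w' (size s) = s]].

Let separated (B : 'I_D.+1 -> set cantor_seq) :=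
  exists2 C : 'I_D.+1 -> set cantor_seq,
    (forall i, measurable (C i) /\ B i `<=` C i) &
    forall x, ~ forall i, C i x.

Let measurable_O s : measurable (O s).
Proof.
apply: (@measurable_agree (size s)) => z z' zz' [x' [w' [Fx' zx' w's]]].
by exists x', w'; split=> //; apply: agree_trans zx'; exact: agree_sym.
Qed.

Let A_O s : A s `<=` O s.
Proof. by move=> x [w Fxw ws]; exists x, w; split. Qed.

Let A_prefix s t : A (s ++ t) `<=` A s.
Proof.
move=> x [w Fx ws]; exists w => //.
by rewrite -[in RHS](take_size_cat t (erefl (size s))) -ws -map_take
  take_iota size_cat (minn_idPl (leq_addr _ _)).
Qed.

Let A_rcons s x : A s x -> exists a, A (rcons s a) x.
Proof.
move=> [w Fx ws]; exists (w (size s)), w => //.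
by rewrite size_rcons mkseqS ws.
Qed.

Let O_limit x w : (forall n, O (mkseq w n) x) -> F x w.
Proof.
move=> Ox; apply: F_closed => n; have [x' [w' []]] := Ox n.
rewrite size_mkseq => Fx' xx' /mkseq_agree w'w.
by exists x', w'; split=> //; exact: agree_sym.
Qed.

(** The separators of the pieces [B' a] are united at the index [i0] and intersected at the others;
    both operations are countable. *)
Let separated_bigcup (B : 'I_D.+1 -> set cantor_seq) i0
    (B' : L -> set cantor_seq) :
  B i0 `<=` \bigcup_a B' a ->
  (forall a, separated (fun i => if i == i0 then B' a else B i)) ->
  separated B.
Proof.
move=> BB' sepB'.
have /choice[C CP] : forall a, exists C : 'I_D.+1 -> set cantor_seq,
    (forall i, measurable (C i) /\ (if i == i0 then B' a else B i) `<=` C i) /\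
    forall x, ~ forall i, C i x.
  by move=> a; have [C ? ?] := sepB' a; exists C.
exists (fun i => if i == i0 then [set x | exists a, C a i0 x]
                 else [set x | forall a, C a i x]).
  move=> i; case: eqVneq => [->|ii0].
    split; first by apply: measurable_prop_exists => a; have [/(_ i0)[]] := CP a.
    move=> x /BB'[a _ B'ax]; exists a.
    by have [/(_ i0)[_]] := CP a; rewrite eqxx => + _; exact.
  split; first by apply: measurable_prop_forall => a; have [/(_ i)[]] := CP a.
  by move=> x Bix a; have [/(_ i)[_]] := CP a; rewrite (negPf ii0) => + _; exact.
move=> x Cx; have := Cx i0; rewrite eqxx => -[a Ca].
have [_ /(_ x)] := CP a; apply=> i.
by have := Cx i; case: eqVneq => [->//|_]; exact.
Qed.

(** One index at a time is passed to a child, by [separated_bigcup] for the countable cover of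
    [A (s i0)] by its children. *)
Let not_separated_rcons (s : 'I_D.+1 -> seq L) :
  ~ separated (fun i => A (s i)) ->
  exists a : {ffun 'I_D.+1 -> L}, ~ separated (fun i => A (rcons (s i) (a i))).
Proof.
move=> nsep.
suff [a aP] : exists a : {ffun 'I_D.+1 -> L}, ~ separated (fun i =>
    A (if i \in enum 'I_D.+1 then rcons (s i) (a i) else s i)).
  exists a; apply: contra_not aP => -[C CP C0]; exists C => // i.
  by have [mC sAC] := CP i; rewrite mem_enum.
have [a0 _] : exists a0 : L, True.
  apply: contrapT => noL; apply: nsep; exists (fun=> set0) => [i|x /(_ ord0)//].
  split=> // x [w _ _]; apply: noL; by exists (w 0%N).
elim: (enum _) => [|i0 l [a IH]]; first by exists [ffun=> a0].
have [i0l|i0l] := boolP (i0 \in l).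
  exists a; apply: contra_not IH => -[C CP C0]; exists C => // i.
  have [mC sAC] := CP i; split=> //; apply: subset_trans sAC.
  by rewrite inE; case: eqVneq => [->|_]; rewrite ?i0l; exact: subset_refl.
apply: contrapT => /forallNP nex; apply: IH.
apply: (@separated_bigcup _ i0 (fun b => A (rcons (s i0) b))).
  by rewrite (negPf i0l) => x /A_rcons[b Ab]; exists b.
move=> b; have /contrapT := nex [ffun i => if i == i0 then b else a i].
move=> [C CP C0]; exists C => // i; have [mC sAC] := CP i; split=> //.
apply: subset_trans sAC; rewrite inE ffunE.
by case: eqVneq => [->|_]; exact: subset_refl.
Qed.

(* Novikov's separation: otherwise some tuple of children is inseparable too,
   and so on; the [O]'s along these [D.+1] branches meet at every level, hence
   by compactness in a point having [D.+1] witnesses. *)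
Let separated_nodes (s : 'I_D.+1 -> seq L) N :
  (forall i, size (s i) = N) -> injective s -> separated (fun i => A (s i)).
Proof.
move=> sN sinj; apply: contrapT => nsep.
pose P (v : seq {ffun 'I_D.+1 -> L}) :=
  ~ separated (fun i => A (s i ++ [seq a i | a : {ffun 'I_D.+1 -> L} <- v])).
have [||v vP] := @dependent_choice_seq _ P [::].
- rewrite /P; apply: contra_not nsep => -[C CP C0]; exists C => // i.
  by have := CP i; rewrite cats0.
- move=> v /not_separated_rcons[a aP]; exists a; apply: contra_not aP.
  move=> -[C CP C0]; exists C => // i.
  by have := CP i; rewrite map_rcons rcons_cat.
have [a0 _] : exists a0 : {ffun 'I_D.+1 -> L}, True by exists (v 0%N).
(* The branch of index [i] starts with the node [s i] and continues with the [i]-th letters of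
   [v]. *)
pose w i n := if (n < N)%N then nth (a0 i) (s i) n else v (n - N)%N i.
have wE i n : mkseq (w i) (N + n) = s i ++ [seq a i | a : {ffun 'I_D.+1 -> L} <- mkseq v n].
  apply: (@eq_from_nth _ (a0 i)) => [|j].
    by rewrite size_mkseq size_cat sN size_map size_mkseq.
  rewrite size_mkseq => jlt; rewrite nth_mkseq// nth_cat sN /w.
  case: ltnP => // Nj; rewrite (nth_map a0); last by rewrite size_mkseq ltn_subLR.
  by rewrite nth_mkseq// ltn_subLR.
have wO n : exists x, forall i, O (mkseq (w i) n) x.
  apply: contrapT => /forallNP nx; apply: (vP n).
  exists (fun i => O (mkseq (w i) n)); last exact: nx.
  move=> i; split=> //; apply: subset_trans (@A_O _).
  by rewrite -wE addnC /mkseq iotaD map_cat; exact: A_prefix.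
(* The point found so far depends on the level; König's lemma on prefixes gives one point for all
   levels. *)
have [x xP] : exists x : nat -> bool, forall n i, O (mkseq (w i) n) x.
  have [||n|x xP] := @konig bool (fun t => forall i, exists x' w',
    [/\ F x' w', mkseq x' (size t) = t & agree (size t) w' (w i)]).
  - move=> t u Ptu i; have [x' [w' [Fx' xt ww]]] := Ptu i.
    exists x', w'; split=> //.
      by rewrite -[in RHS](take_size_cat u (erefl (size t))) -xt -map_take
        take_iota size_cat (minn_idPl (leq_addr _ _)).
    by apply: agreeW ww; rewrite size_cat leq_addr.
  - by move=> t; exists [:: true; false] => -[]; rewrite !inE.
  - have [x xP] := wO n; exists (mkseq x n) => [|i]; rewrite size_mkseq//.
    have [x' [w' []]] := xP i; rewrite size_mkseq => Fx' xx' /mkseq_agree ww'.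
    by exists x', w'; split=> //; apply/mkseq_agree/agree_sym.
  exists x => n i; have [x' [w' []]] := xP n i; rewrite size_mkseq.
  move=> Fx' /mkseq_agree xx' ww'; exists x', w'; rewrite size_mkseq.
  by split=> //; [exact: agree_sym|apply/mkseq_agree].
apply: (@F_bounded x w) => [i|i j wij]; first by apply: O_limit => n.
apply: sinj; apply: (@eq_from_nth _ (a0 i)) => [|n]; rewrite !sN// => nN.
have := congr1 (fun f => f n) wij; rewrite /w nN => ->.
by apply: set_nth_default; rewrite sN.
Qed.

(** The Lusin-Novikov theorem for sections of at most [D] points. The sets [A s] are enlarged to
    measurable sets [B s], cut down by all separators, so that a point lies in few of them at each
    level. *)
Lemma measurable_bounded_projection :
  measurable [set x : cantor_seq | exists w, F x w].
Proof.
pose good (s : {ffun 'I_D.+1 -> seq L}) :=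
  (exists N, forall i, size (s i) = N) /\ injective s.
have /choice[C CP] : forall s, exists C : 'I_D.+1 -> set cantor_seq,
    good s -> (forall i, measurable (C i) /\ A (s i) `<=` C i) /\
              forall x, ~ forall i, C i x.
  move=> s; have [[[N sN] sinj]|ng] := pselect (good s); last by exists (fun=> set0).
  by have [C ? ?] := separated_nodes sN sinj; exists C.
(* At each level at most [D] of the sets [B s] contain a given point, so
   König's lemma finds a witness for a point in some [B s] at every level. *)
pose B (s : seq L) := [set x | O s x /\ forall (t : {ffun 'I_D.+1 -> seq L}) i,
  (good t /\ t i = s) -> C t i x].
have mB s : measurable (B s).
  apply: measurable_prop_and; first exact: measurable_O.
  apply: measurable_prop_forall => t; apply: measurable_prop_forall => i.
  by apply: measurable_prop_imply => -[/CP[/(_ i)[]]].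
have AB s : A s `<=` B s.
  move=> x Ax; split; first exact: A_O.
  by move=> t i [/CP[/(_ i)[_ sAC] _] ti]; apply: sAC; rewrite ti.
(* Otherwise [D.+1] distinct nodes of length [N] whose sets contain [x] form a good tuple with [x]
   in all its separators. *)
have B_bounded N x : exists l : seq (seq L),
    forall s, size s = N -> B s x -> s \in l.
  apply: contrapT => /forallNP nl.
  have [l [lu lN lB]] : exists l : seq (seq L), [/\ uniq l, size l = D.+1 &
      forall s, s \in l -> size s = N /\ B s x].
    elim: D.+1 => [|n [l [lu lN lB]]]; first by exists [::].
    have /existsNP[s /not_implyP[sN /not_implyP[Bs /negP sl]]] := nl l.
    exists (s :: l); split=> [||t]; rewrite /= ?sl ?lu ?lN//.
    by rewrite inE => /orP[/eqP->//|/lB].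
  pose t := [ffun i : 'I_D.+1 => nth [::] l i].
  have tl i : t i \in l by rewrite ffunE mem_nth// lN.
  have gt : good t.
    split; first by exists N => i; have [] := lB _ (tl i).
    move=> i j; rewrite !ffunE => /eqP; rewrite nth_uniq ?lN//.
    by move/eqP/val_inj.
  have [_ /(_ x)] := CP _ gt; apply=> i.
  by have [_ [_]] := lB _ (tl i); apply.
(* Requiring all prefixes makes the nodes at [x] a tree. *)
pose B' (s : seq L) := [set x | forall n, B (take n s) x].
have mB' s : measurable (B' s) by apply: measurable_prop_forall => n; exact: mB.
rewrite (_ : [set x | _] = [set x | forall n, exists s, size s = n /\ B' s x]).
  apply: measurable_prop_forall => n; apply: measurable_prop_exists => s.
  by apply: measurable_prop_and; [exact: measurable_prop_cst|exact: mB'].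
apply/seteqP; split=> x /=.
  move=> [w Fw] n; exists (mkseq w n); split; first by rewrite size_mkseq.
  move=> m; apply: AB; exists w => //.
  by rewrite /mkseq -map_take take_iota size_map size_iota.
move=> xP; have [||n|w wP] := @konig L (fun s => B' s x).
- move=> s t Bst n; have [ns|sn] := leqP n (size s).
    by have := Bst n; rewrite takel_cat.
  by have := Bst (size s); rewrite take_size_cat// take_oversize// ltnW.
- move=> s; have [l lP] := B_bounded (size s).+1 x.
  exists [seq last a t | t <- l, a <- t] => a Ba.
  apply/allpairsPdep; exists (rcons s a), a; split; last by rewrite last_rcons.
    apply: lP; first by rewrite size_rcons.
    by have := Ba (size s).+1; rewrite take_oversize// size_rcons.
  by rewrite mem_rcons mem_head.
- by have [s [sn Bs]] := xP n; exists s.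
exists w; apply: O_limit => n; have := wP n n.
by rewrite take_oversize ?size_mkseq// => -[].
Qed.

End bounded_sections.

(** * Neighborhoods in a Borel graph *)

Section unique_witness.
Variable A : Type.
Implicit Types S : set (nat -> A).

(** [S] is the projection of a closed subset of the product with the Baire space, and the projection
    is injective there. Uniqueness is what later keeps sections bounded. *)
Definition unique_witness S := exists F : (nat -> A) -> (nat -> nat) -> Prop,
  [/\ seq_closed F, forall z w w', F z w -> F z w' -> w = w' &
      forall z, S z <-> exists w, F z w].

Lemma unique_witness_closed S :
  (forall z, (forall n, exists2 z', agree n z z' & S z') -> S z) ->
  unique_witness S.
Proof.
move=> Scl; exists (fun z w => S z /\ w = cst 0%N); split.
- move=> z w zw; split.
    by apply: Scl => n; have [z' [w' [zz' _ [Sz' _]]]] := zw n; exists z'.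
  apply/funext => n; have [z' [w' [_ ww' [_ w'0]]]] := zw n.+1.
  by rewrite ww'// w'0.
- by move=> z w w' [_ ->] [_ ->].
- by move=> z; split=> [Sz|[w []//]]; exists (cst 0%N).
Qed.

(** A witness for the intersection interleaves witnesses for all [S j] through the coding of pairs
    [(j, i)]; entries that code no pair are set to [0] for uniqueness. *)
Lemma unique_witness_bigcap (S : nat -> set (nat -> A)) :
  (forall j, unique_witness (S j)) -> unique_witness (\bigcap_j S j).
Proof.
move=> /choice[F FP].
pose sec (w : nat -> nat) (j i : nat) := w (choice.pickle (j, i)).
exists (fun z w => (forall j, F j z (sec w j)) /\
  forall m, pickle_inv m = None :> option (nat * nat) -> w m = 0%N); split.
- move=> z w zw; split=> [j|m mN].
    have [Fcl _ _] := FP j; apply: Fcl => n.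
    (* The first [n] entries of the [j]-th component sit at places below [N]. *)
    pose N := maxn n (\max_(i < n) (choice.pickle (j, val i)).+1).
    have [z' [w' [zz' ww' [Fz' _]]]] := zw N.
    exists z', (sec w' j); split=> //; first by apply: agreeW zz'; exact: leq_maxl.
    move=> i ilt; apply: ww'; apply: leq_trans (leq_maxr _ _).
    by rewrite -[i]/(val (Ordinal ilt)); exact: leq_bigmax.
  have [z' [w' [_ ww' [_ w'0]]]] := zw m.+1.
  by rewrite ww'// w'0.
- move=> z w w' [Fw w0] [Fw' w'0]; apply/funext => m.
  case e : (pickle_inv m : option (nat * nat)) => [[j i]|]; last by rewrite w0// w'0.
  have := pickle_invK (T := (nat * nat)%type) m; rewrite e /= => <-.
  have [_ Fu _] := FP j.
  by have := congr1 (fun f => f i) (Fu _ _ _ (Fw j) (Fw' j)).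
- move=> z; split=> [Sz|[w [Fw _]] j _]; last first.
    by have [_ _ ->] := FP j; exists (sec w j).
  have /choice[w wP] : forall j, exists w, F j z w.
    by move=> j; have [_ _ <-] := FP j; exact: Sz.
  exists (fun m => if pickle_inv m is Some p then w p.1 p.2 else 0%N).
  split=> [j|m ->//].
  suff -> : sec (fun m => if pickle_inv m is Some p then w p.1 p.2 else 0%N) j = w j by [].
  by apply/funext => i; rewrite /sec pickleK_inv.
Qed.

(** The first entry of a witness names the set; it is unique since the sets are disjoint. *)
Lemma unique_witness_bigcup (S : nat -> set (nat -> A)) :
  (forall j, unique_witness (S j)) ->
  (forall i j z, S i z -> S j z -> i = j) -> unique_witness (\bigcup_j S j).
Proof.
move=> /choice[F FP] Sdisj.
exists (fun z w => F (w 0%N) z (fun i => w i.+1)); split.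
- move=> z w zw; have [Fcl _ _] := FP (w 0%N); apply: Fcl => n.
  have [z' [w' [zz' ww' Fz']]] := zw n.+1.
  exists z', (fun i => w' i.+1); split.
  + exact: agreeW zz'.
  + by move=> i ilt; apply: ww'.
  + by rewrite ww'.
- move=> z w w' Fw Fw'.
  have e : w 0%N = w' 0%N.
    apply: (Sdisj _ _ z).
      by have [_ _ ->] := FP (w 0%N); exists (fun i => w i.+1).
    by have [_ _ ->] := FP (w' 0%N); exists (fun i => w' i.+1).
  apply/funext => -[//|i]; rewrite -e in Fw'.
  have [_ Fu _] := FP (w 0%N).
  exact: (congr1 (fun f => f i) (Fu _ _ _ Fw Fw')).
- move=> z; split=> [[j _ Sj]|[w Fw]]; last first.
    by exists (w 0%N) => //; have [_ _ ->] := FP (w 0%N); exists (fun i => w i.+1).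
  have [_ _ /(_ z)[/(_ Sj)[w Fw] _]] := FP j.
  by exists (fun i => if i is i'.+1 then w i' else j).
Qed.

Lemma unique_witnessI S1 S2 :
  unique_witness S1 -> unique_witness S2 -> unique_witness (S1 `&` S2).
Proof.
move=> S1u S2u; rewrite -bigcap2E.
rewrite (_ : \bigcap_n _ = \bigcap_n (if n is 0%N then S1 else S2)).
  by apply: unique_witness_bigcap => -[].
apply/seteqP; split=> z Sz => [[|i] _|i _].
- exact: (Sz 0%N).
- exact: (Sz 1%N).
- case: i => [|[|//]]; [exact: (Sz 0%N)|exact: (Sz 1%N)].
Qed.

(* Borel sets have unique closed witnesses: the sets that have one together
   with their complement form a sigma-algebra, a countable union being made
   disjoint first. *)
Lemma measurable_unique_witness S :
  <<s @cylinders A >> S -> unique_witness S.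
Proof.
pose bi S := unique_witness S /\ unique_witness (~` S).
suff : <<s @cylinders A >> `<=` bi by move=> sub /sub[].
apply: smallest_sub.
  split.
  - split; apply: unique_witness_closed => z zn.
      by have [z' _ []] := zn 0%N.
    by [].
  - by move=> B [Bu Cu]; rewrite setTD; split=> //; rewrite setCK.
  - move=> B Bu; split; last first.
      by rewrite setC_bigcup; apply: unique_witness_bigcap => j; have [] := Bu j.
    rewrite (_ : \bigcup_k _ = \bigcup_j (B j `&` \bigcap_i
        (if (i < j)%N then ~` B i else setT))).
      apply: unique_witness_bigcup => [j|i j z [Bi nBi] [Bj nBj]].
        apply: unique_witnessI; first by have [] := Bu j.
        apply: unique_witness_bigcap => i; case: ifP => _; first by have [] := Bu i.
        exact: unique_witness_closed.
      have [ij|ji|//] := ltngtP i j.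
        by have := nBj i I; rewrite ij.
      by have := nBi j I; rewrite ji.
    apply/seteqP; split=> z; last by move=> [j _ [Bj _]]; exists j.
    move=> [j0 _ Bj0].
    have ex : exists j, `[< B j z >] by exists j0; apply/asboolP.
    case: (ex_minnP ex) => j /asboolP Bj jmin; exists j => //; split=> // i _.
    case: ifP => // ij Bi; have /asboolP/jmin := Bi.
    by rewrite leqNgt ij.
move=> _ [n [a ->]]; split; apply: unique_witness_closed => z zn.
  by have [z' zz' <-] := zn n.+1; rewrite -zz'.
by have [z' zz' + zna] := zn n.+1; rewrite /= -zz'.
Qed.

End unique_witness.

(** * Measurability of the set of points with a neighbor in a given set *)

Lemma measurable_preimage d d' (T : measurableType d) (T' : measurableType d')
    (f : T -> T') (B : set T') :
  measurable_fun setT f -> measurable B -> measurable (f @^-1` B).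
Proof. by move=> mf mB; rewrite -[X in measurable X]setTI; exact: mf. Qed.

Lemma measurable_fun_cantor d (T : measurableType d) (f : T -> cantor_seq) :
  measurable_fun setT f <-> forall n, measurable [set x | f x n = true].
Proof.
split=> [mf n|mf]; first exact: (measurable_preimage mf (measurable_coord n true)).
apply: (@measurability _ _ T cantor_seq setT f (@cylinders bool)) => //.
move=> _ [_ [n [a ->]] <-]; rewrite setTI; case: a; first exact: mf.
rewrite (_ : _ @^-1` _ = [set x | ~ f x n = true]); last first.
  by apply/seteqP; split=> x /=; case: (f x n).
exact: measurable_prop_not.
Qed.

Lemma measurable_eq_cantor d (T : measurableType d) (f g : T -> cantor_seq) :
  measurable_fun setT f -> measurable_fun setT g ->
  measurable [set x | f x = g x].
Proof.
move=> mf mg; rewrite (_ : [set x | _] = [set x | forall n : nat,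
    exists b : bool, f x n = b /\ g x n = b]).
  apply: measurable_prop_forall => n; apply: measurable_prop_exists => b.
  apply: measurable_prop_and.
    exact: (measurable_preimage mf (measurable_coord n b)).
  exact: (measurable_preimage mg (measurable_coord n b)).
apply/seteqP; split=> x /=; first by move=> -> n; exists (g x n).
by move=> fg; apply/funext => n; have [b [-> ->]] := fg n.
Qed.

(** The retraction [g] makes the range of [h] measurable: it consists of the [z] with
    [h (g z) = z]. *)
Definition cantor_coding d (T : measurableType d) (h : T -> cantor_seq)
    (g : cantor_seq -> T) :=
  [/\ measurable_fun setT h, measurable_fun setT g & cancel h g].

Definition bounded_degree (T : Type) (D : nat) (E : set (T * T)) :=
  forall x (y : 'I_D.+1 -> T), (forall i, E (x, y i)) -> ~ injective y.

Definition neighbors (T : Type) (E : set (T * T)) (A : set T) : set T :=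
  [set x | exists y, A y /\ E (x, y)].

(** In codes, the set is a projection of the measurable set [S], hence of a closed set with unique
    witnesses. The code of a neighbor together with its witness is determined by the neighbor, so
    the sections have at most [D] points and Lusin-Novikov applies. *)
Lemma measurable_neighbors d (T : measurableType d) (h : T -> cantor_seq)
    (g : cantor_seq -> T) (E : set (T * T)) D A :
  cantor_coding h g -> measurable E -> bounded_degree D E ->
  measurable A -> measurable (neighbors E A).
Proof.
move=> [mh mg hK] mE ED mA.
(* A sequence of pairs of bits codes a pair of points of the Cantor space. *)
pose Z := g_sigma_algebraType (@cylinders (bool * bool)).
pose u (z : Z) : cantor_seq := fst \o z; pose v (z : Z) : cantor_seq := snd \o z.
have mZ n a : measurable [set z : Z | z n = a].
  by apply: sub_sigma_algebra; exists n, a.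
have mu : measurable_fun setT u.
  apply/measurable_fun_cantor => n.
  rewrite (_ : [set z | _] = [set z : Z | exists b, z n = (true, b)]).
    by apply: measurable_prop_exists => b; exact: mZ.
  apply/seteqP; split=> z; rewrite /u /=; last by move=> [b ->].
  by case: (z n) => a b /= ->; exists b.
have mv : measurable_fun setT v.
  apply/measurable_fun_cantor => n.
  rewrite (_ : [set z | _] = [set z : Z | exists b, z n = (b, true)]).
    by apply: measurable_prop_exists => b; exact: mZ.
  apply/seteqP; split=> z; rewrite /v /=; last by move=> [b ->].
  by case: (z n) => a b /= ->; exists a.
have mgu := measurableT_comp mg mu; have mgv := measurableT_comp mg mv.
(* The first two conditions restrict to codes of points of [T], on which [g] is injective. *)
pose S := [set z : Z | (h (g (u z)) = u z /\ h (g (v z)) = v z) /\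
                       (A (g (v z)) /\ E (g (u z), g (v z)))].
have : measurable S.
  apply: measurable_prop_and; apply: measurable_prop_and.
  - by apply: measurable_eq_cantor => //; exact: measurableT_comp mgu.
  - by apply: measurable_eq_cantor => //; exact: measurableT_comp mgv.
  - exact: (measurable_preimage mgv).
  - exact: (measurable_preimage (measurable_fun_pair mgu mgv)).
move=> /measurable_unique_witness[F [Fcl Fu SF]].
(* [w] carries both the code of the neighbor and the witness for membership in [S]. *)
pose mix (x : cantor_seq) (w : nat -> bool * nat) : Z := fun n => (x n, (w n).1).
pose F' x w := F (mix x w) (fun n => (w n).2).
have F'cl : seq_closed F'.
  move=> x w xw; apply: Fcl => n; have [x' [w' [xx' ww' Fx']]] := xw n.
  exists (mix x' w'), (fun n => (w' n).2); split=> //.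
    by move=> i ilt; rewrite /mix xx'// ww'.
  by move=> i ilt; rewrite ww'.
have F'bd (x : cantor_seq) (w : 'I_D.+1 -> nat -> bool * nat) :
    (forall i, F' x (w i)) -> ~ injective w.
  move=> Fw winj; have Sw i : S (mix x (w i)) by apply/SF; exists (fun n => (w i n).2); exact: Fw.
  apply: (@ED (g x) (fun i => g (v (mix x (w i))))) => [i|i j /(congr1 h)].
    by have [_ []] := Sw i.
  have [[_ ->] _] := Sw i; have [[_ ->] _] := Sw j => vij.
  have vijn n : (w i n).1 = (w j n).1 := congr1 (fun f => f n) vij.
  apply: winj; have mixij : mix x (w i) = mix x (w j).
    by apply/funext => n; rewrite /mix vijn.
  have := Fw j; rewrite /F' -mixij => /(Fu _ _ _ (Fw i)) wij.
  apply/funext => n.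
  have wijn : (w i n).2 = (w j n).2 := congr1 (fun f => f n) wij.
  by rewrite [LHS]surjective_pairing vijn wijn -surjective_pairing.
rewrite (_ : neighbors E A = h @^-1` [set x | exists w, F' x w]).
  apply: (measurable_preimage mh); exact: (measurable_bounded_projection F'cl F'bd).
apply/seteqP; split=> x /=.
  move=> [y [Ay Exy]].
  have : S (fun n => (h x n, h y n)).
    by rewrite /S /u /v /comp /= -!/(h _) !hK.
  move/SF => [w Fw]; exists (fun n => (h y n, w n)); exact: Fw.
move=> [w Fw]; have [_ [Ay Exy]] : S (mix (h x) w) by apply/SF; exists (fun n => (w n).2).
exists (g (v (mix (h x) w))); split=> //.
by rewrite -[X in E (X, _)](hK x).
Qed.

(** * Coding a standard Borel space *)

Lemma metric_openP (R : realType) (X : metricType R) (U : set X) :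
  open U <->
  forall x, U x -> exists2 e, 0 < e & forall y, mdist x y < e -> U y.
Proof.
rewrite openE /interior; split=> Uo x /Uo.
  move/nbhs_ballP => [e /= e0 eU]; exists e => // y xy.
  by apply: eU; rewrite ballEmdist.
move=> [e e0 eU]; apply/nbhs_ballP; exists e => //= y.
by rewrite ballEmdist; exact: eU.
Qed.

Lemma separable_seq (R : realType) (X : metricType R) (x0 : X) :
  separable X ->
  exists s : nat -> X, forall x (e : R), 0 < e -> exists i, mdist x (s i) < e.
Proof.
move=> [S /countable_injP[F Finj] Sd].
have /choice[s sP] : forall n, exists x, (exists2 y, S y & F y = n) -> S x /\ F x = n.
  move=> n; have [[y Sy Fy]|ny] := pselect (exists2 y, S y & F y = n).
    by exists y.
  by exists x0.
exists s => x e e0.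
have [||y [+ Sy]] := Sd [set y | mdist x y < e].
- by exists x; rewrite /= mdistxx.
- apply/metric_openP => y /= xy; exists (e - mdist x y); first by rewrite subr_gt0.
  by move=> z yz; rewrite (le_lt_trans (metric_triangle _ y _))// -ltrBrDl.
rewrite /= => xy; exists (F y).
have [sS sF] := sP (F y) (ex_intro2 _ _ y Sy erefl).
suff -> : s (F y) = y by [].
by apply: Finj => //; rewrite inE.
Qed.

(** A point is determined by its distances to a dense sequence, rounded to bits. By completeness,
    the sequences that decode to a point are described by countably many conditions on bits, so
    decoding is measurable. *)
Lemma standard_borel_coding (R : realType) d (T : measurableType d) :
  standard_borel R T ->
  exists (h : T -> cantor_seq) (g : cantor_seq -> T), cantor_coding h g.
Proof.
move=> [X [Xc Xs [f [f' fK f'K] Tm]]].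
pose x0 := f point.
have [s sd] := separable_seq x0 Xs.
pose r k : R := k.+1%:R^-1.
have r0 k : 0 < r k by rewrite invr_gt0.
have rP (e : R) : 0 < e -> exists k, r k < e.
  by move=> /ltr_add_invr[k]; rewrite add0r; exists k.
have r_le k l : (k <= l)%N -> r l <= r k.
  by move=> kl; rewrite lef_pV2 ?posrE// ler_nat ltnS.
(* [x] is coded by the bits [mdist x (s i) < r k], and decoded as the limit over
   [k] of the points [s i], where [i] is the least index whose [k]-th bit is
   set. *)
pose code (i k : nat) := choice.pickle (i, k).
pose I (z : cantor_seq) k i := z (code i k) = true /\
  forall j, (j < i)%N -> z (code j k) = false.
pose lim z y := forall k, exists2 i, I z k i & mdist y (s i) <= r k.
have lim_unique z y y' : lim z y -> lim z y' -> y = y'.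
  move=> zy zy'; apply/eqP; rewrite -[_ == _]negbK -mdist_gt0; apply/negP => yy'.
  have [k kd] : exists k, r k < mdist y y' / 2 by apply: rP; rewrite divr_gt0.
  have [i [zi zlti] yi] := zy k; have [j [zj zltj] yj] := zy' k.
  have ij : i = j.
    have [/zltj|/zlti|//] := ltngtP i j; first by rewrite zi.
    by rewrite zj.
  rewrite -ij metric_sym in yj.
  have := metric_triangle y (s i) y'; apply/negP; rewrite -ltNge.
  by rewrite (splitr (mdist y y')) ltrD// (le_lt_trans _ kd).
(* A Cauchy condition on the selected points, equivalent to the existence of a limit but with
   countable quantifiers only. *)
pose D z := forall k l, exists i j, (I z k i /\ I z l j) /\
  mdist (s i) (s j) <= r k + r l.
have limD z : (exists y, lim z y) <-> D z.
  split=> [[y zy] k l|zD].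
    have [i Ii yi] := zy k; have [j Ij yj] := zy l.
    exists i, j; split=> //.
    by rewrite (le_trans (metric_triangle _ y _))// lerD// metric_sym.
  have /choice[a aI] : forall k, exists i, I z k i.
    by move=> k; have [i [j [[Ii _] _]]] := zD k k; exists i.
  have aD k l : mdist (s (a k)) (s (a l)) <= r k + r l.
    have [i [j [[[zi zlti] [zj zltj]] sij]]] := zD k l.
    have [zk zltk] := aI k; have [zl zltl] := aI l.
    have <- : i = a k.
      have [/zltk|/zlti|//] := ltngtP i (a k); first by rewrite zi.
      by rewrite zk.
    suff <- : j = a l by [].
    have [/zltl|/zltj|//] := ltngtP j (a l); first by rewrite zj.
    by rewrite zl.
  have [|y /cvg_ballP ay] := Xc ((s \o a) @ \oo) _.
    apply: cauchy_exP => e e0.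
    have [k ke] : exists k, r k < e / 2 by apply: rP; rewrite divr_gt0.
    exists (s (a k)); exists k => // l /= kl.
    rewrite ballEmdist /= (le_lt_trans (aD _ _))// (splitr e) ltr_leD//.
    by rewrite (le_trans (r_le _ _ kl))// ltW.
  exists y => k; exists (a k) => //.
  apply/ler_addgt0Pr => e e0.
  have e20 : 0 < e / 2 by rewrite divr_gt0.
  have [l0 l0e] := rP _ e20; have [l1 _ l1P] := ay _ e20.
  pose l := maxn l0 l1.
  have := l1P l (leq_maxr _ _); rewrite /= ballEmdist /= => yl.
  rewrite (le_trans (metric_triangle _ (s (a l)) _))//.
  rewrite (le_trans (lerD (ltW yl) (aD l k)))// addrA addrC lerD2l.
  rewrite [leRHS]splitr lerD2l ltW// (le_lt_trans _ l0e)//.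
  by rewrite r_le// leq_maxl.
have mI k i : measurable [set z | I z k i].
  apply: measurable_prop_and; first exact: measurable_coord.
  apply: measurable_prop_forall => j; apply: measurable_prop_imply => _.
  exact: measurable_coord.
have mD : measurable [set z | D z].
  do 2 apply: measurable_prop_forall => ?; do 2 apply: measurable_prop_exists => ?.
  apply: measurable_prop_and; last exact: measurable_prop_cst.
  by apply: measurable_prop_and; exact: mI.
have /choice[lm lmP] : forall z, exists y, (D z -> lim z y) /\ (~ D z -> y = x0).
  move=> z; have [Dz|nDz] := pselect (D z); last by exists x0.
  by have /limD[y zy] := Dz; exists y.
have lmE z y : lim z y -> lm z = y.
  move=> zy; have [zD _] := lmP z; apply: (lim_unique z) => //.
  by apply: zD; apply/limD; exists y.
have mlm_open (U : set X) : open U -> measurable [set z | U (lm z)].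
  (* On [D], the decoded point is in [U] exactly if [U] contains the closed ball selected at some
     precision [k]. *)
  move=> /metric_openP Uo; rewrite (_ : [set z | _] = [set z |
    (D z /\ exists k i, I z k i /\ forall x, mdist x (s i) <= r k -> U x) \/
    (~ D z /\ U x0)]).
    apply: measurable_prop_or; apply: measurable_prop_and.
    - exact: mD.
    - do 2 apply: measurable_prop_exists => ?.
      by apply: measurable_prop_and; [exact: mI|exact: measurable_prop_cst].
    - exact: measurable_prop_not.
    - exact: measurable_prop_cst.
  apply/seteqP; split=> z /=.
    move=> Uz; have [zD znD] := lmP z; have [Dz|nDz] := pselect (D z); last first.
      by right; split=> //; rewrite -znD.
    left; split=> //; have [e e0 eU] := Uo _ Uz.
    have [k ke] : exists k, r k < e / 2 by apply: rP; rewrite divr_gt0.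
    have [i Ii yi] := zD Dz k; exists k, i; split=> // x xi; apply: eU.
    rewrite (le_lt_trans (metric_triangle _ (s i) _))// (splitr e).
    by rewrite ltrD// ?(le_lt_trans _ ke)// metric_sym.
  have [zD znD] := lmP z.
  move=> [[Dz [k [i [[zi zlti] iU]]]]|[nDz Ux0]]; last by rewrite znD.
  apply: iU; have [j [zj zltj] yj] := zD Dz k.
  suff -> : i = j by [].
  have [/zltj|/zlti|//] := ltngtP i j; first by rewrite zi.
  by rewrite zj.
have mlm B : borel B -> measurable [set z | B (lm z)].
  suff : @borel X `<=` [set B | measurable [set z | B (lm z)]] by apply.
  apply: smallest_sub; last by move=> U /mlm_open.
  split => /=; first exact: measurable_prop_cst.
  - move=> A mA; apply: measurable_prop_and; first exact: measurable_prop_cst.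
    exact: measurable_prop_not.
  - move=> A mA; rewrite (_ : [set z | _] = [set z | exists i, A i (lm z)]).
      exact: measurable_prop_exists.
    by apply/seteqP; split=> z [i]; [exists i|exists i].
have f_image (B : set X) : f @` [set t | B (f t)] = B.
  apply/seteqP; split=> [_ [t Bt <-]//|x Bx].
  by exists (f' x) => /=; rewrite f'K.
pose h (t : T) : cantor_seq := fun n =>
  if choice.unpickle n is Some ik then `[< mdist (f t) (s ik.1) < r ik.2 >] else false.
have hP t i k : h t (code i k) = `[< mdist (f t) (s i) < r k >].
  by rewrite /h /code choice.pickleK.
exists h, (f' \o lm); split.
- apply/measurable_fun_cantor => n; rewrite /h.
  case: (choice.unpickle n) => [[i k]|]; last exact: measurable_prop_cst.
  apply/Tm; rewrite (_ : [set t | _] = [set t | [set x | mdist x (s i) < r k] (f t)]).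
    rewrite f_image; apply: sub_sigma_algebra; apply/metric_openP => x /= xi.
    exists (r k - mdist x (s i)); first by rewrite subr_gt0.
    move=> y xy; rewrite (le_lt_trans (metric_triangle _ x _))//.
    by rewrite -ltrBrDr metric_sym.
  by apply/seteqP; split=> t /asboolP.
- move=> _ A /Tm mA; rewrite setTI.
  rewrite (_ : _ @^-1` _ = [set z | (f @` A) (lm z)]); first exact: mlm.
  apply/seteqP; split=> z /=; first by move=> Az; exists (f' (lm z)).
  by move=> [t At <-]; rewrite fK.
- move=> t /=; rewrite (lmE (h t) (f t)) ?fK// => k.
  have ex : exists i, h t (code i k).
    by have [i iP] := sd (f t) (r k) (r0 k); exists i; rewrite hP; apply/asboolP.
  case: (ex_minnP ex) => i hi imin; exists i; last first.
    by move: hi; rewrite hP => /asboolP/ltW.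
  split=> // j ji; apply/negbTE/negP => /imin.
  by rewrite leqNgt ji.
Qed.

(** * Colorings *)

Definition finite_degree (T : eqType) (D : nat) (E : set (T * T)) :=
  forall x, exists2 l : seq T, (size l <= D)%N & forall y, E (x, y) -> y \in l.

Lemma injective_size_seq (T : eqType) (M : nat) (l : seq T) (y : 'I_M.+1 -> T) :
  (size l <= M)%N -> (forall i, y i \in l) -> ~ injective y.
Proof.
move=> lM yl yinj.
have : (size (codom y) <= size l)%N.
  apply: uniq_leq_size; first by rewrite map_inj_uniq ?enum_uniq.
  by move=> _ /codomP[i ->].
by rewrite size_codom card_ord leqNgt ltnS lM.
Qed.

Lemma finite_bounded_degree (T : eqType) D (E : set (T * T)) :
  finite_degree D E -> bounded_degree D E.
Proof.
move=> ED x y Ey; have [l lD lE] := ED x.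
by apply: injective_size_seq lD _ => i; exact: lE.
Qed.

Section walks.
Variables (T : choiceType) (E : set (T * T)).
Hypothesis E_sym : forall x y, E (x, y) -> E (y, x).

Lemma walk_cat m n x y z : walk E m x y -> walk E n y z -> walk E (m + n) x z.
Proof.
elim: m x => [|m IH] x /=; first by move->.
by move=> [u xu uy] yz; exists u => //; exact: IH yz.
Qed.

Lemma walk1 x y : E (x, y) -> walk E 1 x y.
Proof. by exists y. Qed.

Lemma walk_sym n x y : walk E n x y -> walk E n y x.
Proof.
elim: n x => [|n IH] x /=; first by move->.
move=> [z xz /IH zy]; rewrite -/(walk E n.+1 y x) -addn1.
by apply: walk_cat zy _; apply: walk1; exact: E_sym.
Qed.

Lemma gball_refl x r : gball E x r x.
Proof. by exists 0%N. Qed.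

Lemma gball_sym x y r : gball E x r y -> gball E y r x.
Proof. by move=> [n nr /walk_sym]; exists n. Qed.

Lemma gball_trans x y z r s :
  gball E x r y -> gball E y s z -> gball E x (r + s) z.
Proof.
move=> [m mr xy] [n ns yz]; exists (m + n)%N; first exact: leq_add.
exact: walk_cat yz.
Qed.

Lemma gball1 x y : E (x, y) -> gball E x 1 y.
Proof. by move=> xy; exists 1%N => //; exact: walk1. Qed.

Lemma finite_gball D r : finite_degree D E ->
  exists M, forall x,
    exists2 l : seq T, (size l <= M)%N & forall y, gball E x r y -> y \in l.
Proof.
move=> ED.
have flatten_le (K : nat) (ss : seq (seq T)) : (forall s, s \in ss -> (size s <= K)%N) ->
    (size (flatten ss) <= size ss * K)%N.
  elim: ss => //= s ss IH ssK; rewrite size_cat mulSn leq_add//.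
    by apply: ssK; rewrite mem_head.
  by apply: IH => t tss; apply: ssK; rewrite inE tss orbT.
(* The base [D.+1] is positive, so its powers are monotone in [n] also for [D = 0]. *)
have walkM n : exists f : T -> seq T, forall x, (size (f x) <= D.+1 ^ n)%N /\
    forall y, walk E n x y -> y \in f x.
  elim: n => [|n [f fP]]; first by exists (fun x => [:: x]) => x; split=> //= y ->; rewrite inE.
  have /choice[nb nbP] : forall x, exists l : seq T, (size l <= D)%N /\
      forall y, E (x, y) -> y \in l.
    by move=> x; have [l ? ?] := ED x; exists l.
  exists (fun x => flatten [seq f z | z <- nb x]) => x; split.
    have [nbD _] := nbP x.
    apply: leq_trans (@flatten_le (D.+1 ^ n)%N _ _) _.
      by move=> _ /mapP[z _ ->]; have [] := fP z.
    by rewrite size_map expnS leq_mul// (leq_trans nbD).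
  move=> y [z xz zy]; apply/flatten_mapP; exists z.
    by have [_] := nbP x; apply.
  by have [_] := fP z; apply.
have /choice[f fP] := walkM.
exists (r.+1 * D.+1 ^ r)%N => x.
exists (flatten [seq f n x | n <- iota 0 r.+1]).
  rewrite -[X in (_ <= X * _)%N](size_iota 0 r.+1) -(size_map (fun n => f n x)).
  apply: flatten_le => _ /mapP[n nr ->]; have [fx _] := fP n x.
  by apply: leq_trans fx _; rewrite leq_pexp2l//; move: nr; rewrite mem_iota.
move=> y [n nr xy]; apply/flatten_mapP; exists n.
  by rewrite mem_iota /= add0n ltnS.
by have [_] := fP n x; apply.
Qed.

End walks.

Section coloring.
Context d (T : measurableType d) (h : T -> cantor_seq).
Hypothesis mh : measurable_fun setT h.
Hypothesis h_inj : injective h.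

Let prefix (q : seq bool) := [set x | mkseq (h x) (size q) = q].

Let measurable_prefix q : measurable (prefix q).
Proof. exact: (measurable_preimage mh (measurable_mkseq (size q) q)). Qed.

Let separating_prefix (x : T) (l : seq T) :
  exists n, forall y, y \in l -> y != x -> mkseq (h y) n <> mkseq (h x) n.
Proof.
elim: l => [|z l [n nP]]; first by exists 0%N.
have [->|zx] := eqVneq z x.
  by exists n => y; rewrite inE => /orP[/eqP->|]; [rewrite eqxx|exact: nP].
have [i hi] : exists i, h z i <> h x i.
  apply/existsNP => hzx; move/eqP: zx; apply; apply: h_inj; exact/funext.
exists (maxn n i.+1) => y; rewrite inE => /orP[/eqP-> _|yl yx] /mkseq_agree hyx.
  by apply: hi; apply: hyx; exact: leq_maxr.
by apply: (nP y) => //; apply/mkseq_agree; apply: agreeW hyx; exact: leq_maxl.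
Qed.

Section greedy.
Variables (E : set (T * T)) (M : nat).
Hypothesis E_irrefl : forall x, ~ E (x, x).
Hypothesis E_sym : forall x y, E (x, y) -> E (y, x).
Hypothesis ED : finite_degree M E.
Hypothesis mE : forall A, measurable A -> measurable (neighbors E A).

(** Countably many independent measurable sets, indexed by prefixes. They cover, since a long prefix
    tells a point from its finitely many neighbors. *)
Let K (n : nat) : set T := if choice.unpickle n is Some q
  then [set x | prefix q x /\ ~ neighbors E (prefix q) x] else set0.

Let measurable_K n : measurable (K n).
Proof.
rewrite /K; case: (choice.unpickle n : option (seq bool)) => [q|//].
apply: measurable_prop_and; first exact: measurable_prefix.
by apply: measurable_prop_not; apply: mE; exact: measurable_prefix.
Qed.

Let K_independent n x y : K n x -> K n y -> ~ E (x, y).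
Proof.
rewrite /K; case: (choice.unpickle n : option (seq bool)) => [q|//].
by move=> [_ nx] [qy _] xy; apply: nx; exists y.
Qed.

Let K_cover x : exists n, K n x.
Proof.
have [l _ lE] := ED x; have [n nP] := separating_prefix x l.
exists (choice.pickle (mkseq (h x) n)); rewrite /K choice.pickleK.
split; rewrite /prefix /= size_mkseq// => -[y [hy xy]].
apply: (nP y) hy; first exact: lE.
by apply/eqP => yx; apply: (@E_irrefl x); rewrite -{2}yx.
Qed.

(* At stage [n] each uncolored point of the independent set [K n] takes the least
   color that none of its neighbors has. *)
Let Fixpoint stage (n : nat) : nat -> set T := if n is n'.+1 then
  fun j => [set x | stage n' j x \/
    (K n' x /\ (forall i, ~ stage n' i x)) /\
    ((forall i, (i < j)%N -> neighbors E (stage n' i) x) /\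
     ~ neighbors E (stage n' j) x)]
  else fun=> set0.

Let measurable_stage n j : measurable (stage n j).
Proof.
elim: n j => [|n IH] j /=; first exact: measurable0.
apply: measurable_prop_or; first exact: IH.
apply: measurable_prop_and; apply: measurable_prop_and.
- exact: measurable_K.
- by apply: measurable_prop_forall => i; apply: measurable_prop_not; exact: IH.
- apply: measurable_prop_forall => i; apply: measurable_prop_imply => _.
  by apply: mE; exact: IH.
- by apply: measurable_prop_not; apply: mE; exact: IH.
Qed.

Let stage_mono m n j x : (m <= n)%N -> stage m j x -> stage n j x.
Proof. by move=> /subnK <-; elim: (n - m)%N => //= k IH /IH; left. Qed.

Let stage_disjoint n i j x : stage n i x -> stage n j x -> i = j.
Proof.
elim: n => [//|n IH] /=.
move=> [xi|[[_ nx] [xlti nxi]]] [xj|[[_ nx'] [xltj nxj]]].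
- exact: IH.
- by have := nx' i.
- by have := nx j.
- by have [/xltj|/xlti|] := ltngtP i j.
Qed.

(** A newly colored point avoids the colors of its neighbors, and two points colored at the same
    stage lie in one independent set. *)
Let stage_independent n j x y : stage n j x -> stage n j y -> ~ E (x, y).
Proof.
elim: n => [//|n IH] /=.
move=> [xj|[[Kx _] [_ nxj]]] [yj|[[Ky _] [_ nyj]]] xy.
- exact: (IH xj yj xy).
- by apply: nyj; exists x; split=> //; exact: E_sym.
- by apply: nxj; exists y.
- exact: (K_independent Kx Ky xy).
Qed.

(** Pigeonhole: the color classes of a stage are disjoint, so [M.+1] colors around [x] need [M.+1]
    distinct neighbors. *)
Let stage_free n x : ~ forall i, (i <= M)%N -> neighbors E (stage n i) x.
Proof.
move=> /= ex; have [l lM lE] := ED x.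
have /choice[y yP] : forall i : 'I_M.+1, exists y, stage n i y /\ E (x, y).
  by move=> i; apply: ex; rewrite -ltnS.
apply: (injective_size_seq lM (y := y)) => [i|i j yij].
  by apply: lE; have [] := yP i.
apply/val_inj/(@stage_disjoint n _ _ (y i)); first by have [] := yP i.
by rewrite yij; have [] := yP j.
Qed.

Let stage_le n j x : stage n j x -> (j <= M)%N.
Proof.
elim: n => [//|n IH] /= [/IH//|[_ [xj _]]].
rewrite leqNgt; apply/negP => Mj; apply: (@stage_free n x) => i iM.
by apply: xj; exact: leq_ltn_trans Mj.
Qed.

Lemma measurable_coloring : exists C : nat -> set T,
  [/\ forall j, measurable (C j), forall x, exists2 j, (j <= M)%N & C j x &
      forall j x y, E (x, y) -> C j x -> ~ C j y].
Proof.
exists (fun j => [set x | exists n, stage n j x]); split.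
- by move=> j; apply: measurable_prop_exists => n; exact: measurable_stage.
- move=> x; have [n Kx] := K_cover x.
  suff [j xj] : exists j, stage n.+1 j x by exists j; [exact: stage_le xj|exists n.+1].
  have [[j xj]|nx] := pselect (exists j, stage n j x); first by exists j; left.
  have ex : exists j, `[< ~ neighbors E (stage n j) x >].
    apply: contrapT => /forallNP nj; apply: (@stage_free n x) => i _.
    by apply: contrapT => ni; apply: (nj i); apply/asboolP.
  case: (ex_minnP ex) => j /asboolP xj jmin; exists j; right; split; split=> //.
    by move=> i xi; apply: nx; exists i.
  move=> i ij; apply: contrapT => ni; have /asboolP/jmin := ni.
  by rewrite leqNgt ij.
- move=> j x y xy [m xj] [n yj].
  apply: (@stage_independent (maxn m n) j x y) => //.
    by apply: stage_mono xj; exact: leq_maxl.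
  by apply: stage_mono yj; exact: leq_maxr.
Qed.

End greedy.

(** The sets are the classes of a coloring of the graph [Er] that joins distinct points at distance
    at most [r]; balls are bounded in size, so its degrees are too. *)
Lemma measurable_separation D (E : set (T * T)) r :
  (forall x y, E (x, y) -> E (y, x)) -> finite_degree D E ->
  (forall A, measurable A -> measurable (neighbors E A)) ->
  exists M, exists2 C : nat -> set T, forall j, measurable (C j) &
    forall x y, gball E x r y -> x <> y -> exists2 j, (j <= M)%N & C j x /\ ~ C j y.
Proof.
move=> E_sym ED mE; have [M MP] := finite_gball r ED.
pose Er := [set p : T * T | p.1 <> p.2 /\ gball E p.1 r p.2].
have mwalk A n : measurable A -> measurable [set x | exists y, A y /\ walk E n x y].
  move=> mA; elim: n => [|n IH] /=.
    rewrite (_ : [set x | _] = A)//; apply/seteqP; split=> x /=.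
      by move=> [y [Ay ->]].
    by exists x.
  rewrite (_ : [set x | _] = neighbors E [set x | exists y, A y /\ walk E n x y]).
    exact: mE.
  apply/seteqP; split=> x; first by move=> [y [Ay [z xz zy]]]; exists z; split=> //; exists y.
  by move=> [z [[y [Ay zy]] xz]]; exists y; split=> //; exists z.
have [||||C [mC Ccov Cind]] := @measurable_coloring Er M.
- by move=> x [].
- by move=> x y [/= xy /(gball_sym E_sym) yx]; split=> //= /esym.
- by move=> x; have [l lM lP] := MP x; exists l => // y [_ /lP].
(* That [x] and [y] differ is expressed by a prefix [q] of [x] that [y] lacks, which leaves a
   countable union over [q]. *)
- move=> A mA; rewrite (_ : neighbors Er A = [set x | exists q, prefix q x /\
      exists n, (n <= r)%N /\
        exists y, (A y /\ ~ prefix q y) /\ walk E n x y]).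
    apply: measurable_prop_exists => q; apply: measurable_prop_and.
      exact: measurable_prefix.
    apply: measurable_prop_exists => n; apply: measurable_prop_and.
      exact: measurable_prop_cst.
    apply: mwalk; apply: measurable_prop_and; first exact: mA.
    by apply: measurable_prop_not; exact: measurable_prefix.
  apply/seteqP; split=> x /=.
    move=> [y [Ay [/= xy [n nr wxy]]]].
    have [m mP] := separating_prefix x [:: y].
    exists (mkseq (h x) m); rewrite /prefix /= size_mkseq; split=> //.
    exists n; split=> //; exists y; split=> //; split=> //.
    by apply: mP; [rewrite inE|apply/eqP/nesym].
  move=> [q [qx [n [nr [y [[Ay qy] wxy]]]]]]; exists y; split=> //.
  by split; [move=> /= xy; apply: qy; rewrite -xy|exists n].
exists M, C => // x y xy nxy; have [j jM Cx] := Ccov x.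
by exists j => //; split=> //; exact: (Cind j x y).
Qed.

End coloring.

(** * Lifting and separating codes *)

(** A form of uniform continuity of the neighbor sets: [N] is the same for all points, so the
    property survives passage to limits. *)
Definition lifting (T : Type) (E : set (T * T)) (F : T -> nat -> bool) :=
  forall n, exists N, forall x x' y, agree N (F x) (F x') -> E (x, y) ->
    exists2 y', E (x', y') & agree n (F y) (F y').

Definition separating (T : Type) (E : set (T * T)) (F : T -> nat -> bool) :=
  forall r, exists m, forall x y, gball E x r y -> agree m (F x) (F y) -> x = y.

(** The sets are the values of finite expressions over [V], represented as trees; these are
    countable in number. *)
Lemma closed_family d (T : measurableType d) (E : set (T * T))
    (V : nat -> set T) :
  (forall A, measurable A -> measurable (neighbors E A)) ->
  (forall k, measurable (V k)) ->
  exists U : nat -> set T, [/\ forall i, measurable (U i),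
    forall k, exists i, U i = V k, exists i, U i = setT,
    forall i, exists j, U j = ~` U i &
    (forall i j, exists k, U k = U i `&` U j) /\
    (forall i, exists j, U j = neighbors E (U i))].
Proof.
move=> mE mV.
pose fix ev (t : GenTree.tree nat) : set T := match t with
  | GenTree.Leaf k => V k
  | GenTree.Node 0 (t :: _) => ~` ev t
  | GenTree.Node 1 (t :: u :: _) => ev t `&` ev u
  | GenTree.Node _ (t :: _) => neighbors E (ev t)
  | GenTree.Node _ _ => setT
  end.
have mev t : measurable (ev t).
  move: t; fix IH 1 => -[k|n [|t s]]; first exact: mV.
    by case: n => [|[|n]]; exact: measurableT.
  case: n => [|[|n]]; [exact: measurableC|case: s => [|u s]|exact: mE].
    exact: mE.
  exact: measurableI.
pose code := @choice.pickle (GenTree.tree nat).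
pose U i := ev (odflt (GenTree.Leaf 0%N) (choice.unpickle i)).
have UE t : U (code t) = ev t by rewrite /U choice.pickleK.
exists U; split.
- by move=> i; exact: mev.
- by move=> k; exists (code (GenTree.Leaf k)); rewrite UE.
- by exists (code (GenTree.Node 0 [::])); rewrite UE.
- move=> i; pose t := odflt (GenTree.Leaf 0%N) (choice.unpickle i : option (GenTree.tree nat)).
  by exists (code (GenTree.Node 0 [:: t])); rewrite UE.
- split=> i.
    move=> j; pose t := odflt (GenTree.Leaf 0%N) (choice.unpickle i : option (GenTree.tree nat)).
    pose u := odflt (GenTree.Leaf 0%N) (choice.unpickle j : option (GenTree.tree nat)).
    by exists (code (GenTree.Node 1 [:: t; u])); rewrite UE.
  pose t := odflt (GenTree.Leaf 0%N) (choice.unpickle i : option (GenTree.tree nat)).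
  by exists (code (GenTree.Node 2 [:: t])); rewrite UE.
Qed.

Lemma lifting_separating_coding d (T : measurableType d)
    (h : T -> cantor_seq) (g : cantor_seq -> T) (E : set (T * T)) D :
  cantor_coding h g -> measurable E -> (forall x y, E (x, y) -> E (y, x)) ->
  finite_degree D E ->
  exists (F : T -> cantor_seq) (g' : cantor_seq -> T),
    [/\ cantor_coding F g', lifting E F & separating E F].
Proof.
move=> hg mE E_sym ED.
have mN A : measurable A -> measurable (neighbors E A).
  by apply: measurable_neighbors hg mE _; exact: finite_bounded_degree ED.
have [mh mg hK] := hg.
have /choice[M /choice[C CP]] : forall r, exists M, exists C : nat -> set T,
    (forall j, measurable (C j)) /\ forall x y, gball E x r y -> x <> y ->
      exists2 j, (j <= M)%N & C j x /\ ~ C j y.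
  move=> r; have [M [C mC CP]] := measurable_separation mh (can_inj hK) r E_sym ED mN.
  by exists M, C.
pose V k : set T := match choice.unpickle k : option (nat + nat * nat) with
  | Some (inl n) => [set x | h x n = true]
  | Some (inr rj) => C rj.1 rj.2
  | None => setT
  end.
have mV k : measurable (V k).
  rewrite /V; case: (choice.unpickle k : option (nat + nat * nat)) => [[n|[r j]]|//].
    by have /measurable_fun_cantor := mh; exact.
  by have [] := CP r.
have [U [mU UV [iT UT] UC [UI UN]]] := closed_family mN mV.
pose F (x : T) : cantor_seq := fun i => `[< U i x >].
have FP x i : F x i = true <-> U i x by split=> /asboolP.
have /choice[idx idxP] : forall n, exists i, U i = [set x | h x n = true].
  move=> n; have [i Ui] := UV (choice.pickle (inl n : nat + nat * nat)); exists i.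
  by rewrite Ui /V choice.pickleK.
have colP r j : exists i, U i = C r j.
  have [i Ui] := UV (choice.pickle (inr (r, j) : nat + nat * nat)); exists i.
  by rewrite Ui /V choice.pickleK.
(* Classes of agreement are finite Boolean combinations of the [U i], hence members of the
   family. *)
have UA n x : exists i, U i = [set y | agree n (F x) (F y)].
  elim: n => [|n [i Ui]].
    by exists iT; rewrite UT; apply/seteqP; split.
  have [j Uj] : exists j, U j = [set y | F x n = F y n].
    case Fxn : (F x n).
      by exists n; apply/seteqP; split=> y /=; [move/FP|move/esym/FP].
    have [j Uj] := UC n; exists j; rewrite Uj; apply/seteqP; split=> y /=.
      by move=> nU; apply/esym/negP => /FP.
    by move=> Fy /FP; rewrite -Fy.
  have [k Uk] := UI i j; exists k; rewrite Uk Ui Uj.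
  apply/seteqP; split=> y /=.
    by move=> [xy xyn] l; rewrite ltnS leq_eqVlt => /orP[/eqP->//|/xy].
  by move=> xy; split=> [l ln|]; apply: xy => //; exact: ltnW.
exists F, (g \o (fun z n => z (idx n))); split.
- split.
  + apply/measurable_fun_cantor => n; rewrite (_ : [set x | _] = U n)//.
    by apply/seteqP; split=> x /FP.
  + apply: measurableT_comp => //; apply/measurable_fun_cantor => n.
    exact: measurable_coord.
  + move=> x /=; rewrite -[RHS]hK; congr g; apply/funext => n; rewrite /F idxP.
    by apply/asboolP/idP.
- move=> n.
  (* For each of the finitely many prefixes [q] that occur, having a neighbor whose code starts with
     [q] is itself a bit of the code; the final bound goes beyond all these bits. *)
  have /choice[N NP] : forall q : n.-tuple bool, exists N, forall y,
      mkseq (F y) n = q -> exists2 j, (j < N)%N &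
        U j = neighbors E [set y' | agree n (F y) (F y')].
    move=> q; have [[y yq]|ny] := pselect (exists y, mkseq (F y) n = q).
      have [i Ui] := UA n y; have [j Uj] := UN i.
      exists j.+1 => z zq; exists j; rewrite // Uj Ui; congr neighbors.
      have yz : agree n (F y) (F z) by apply/mkseq_agree; rewrite yq zq.
      apply/seteqP; split=> t /=; last exact: agree_trans.
      by apply: agree_trans; exact: agree_sym.
    by exists 0%N => y yq; exfalso; apply: ny; exists y.
  exists (\max_q N q) => x x' y xx' xy.
  have [j jN Uj] := NP (Tuple (introT eqP (size_mkseq (F y) n))) y erefl.
  have Ujx : U j x by rewrite Uj; exists y.
  have : U j x'.
    apply/FP; rewrite -xx'; first exact/FP.
    by apply: leq_trans jN _; exact: leq_bigmax.
  by rewrite Uj => -[y' [yy' xy']]; exists y'.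
- move=> r; have /choice[col colP'] := colP r.
  (* These bits include the membership in every color class for distance [r], and one of those
     classes would contain [x] but not [y]. *)
  exists (\max_(j < (M r).+1) (col j).+1) => x y xy Fxy.
  apply: contrapT => nxy; have [_ CP'] := CP r.
  have [j jM [Cx nCy]] := CP' _ _ xy nxy; apply: nCy.
  rewrite -colP'; apply/FP; rewrite -Fxy; first by apply/FP; rewrite colP'.
  have jM' : (j < (M r).+1)%N by [].
  exact: (@leq_bigmax _ (fun j : 'I_(M r).+1 => (col j).+1) (Ordinal jM')).
Qed.

(** * Completing a graph along a code *)

Lemma gballW (T : Type) (E : set (T * T)) x r s :
  (r <= s)%N -> gball E x r `<=` gball E x s.
Proof. by move=> rs y [n nr xy]; exists n => //; exact: leq_trans rs. Qed.

Section local_isomorphisms.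
Variables (T : choiceType) (E : set (T * T)) (F : T -> nat -> bool).
Hypothesis E_sym : forall x y, E (x, y) -> E (y, x).
Hypothesis E_lift : lifting E F.
Hypothesis E_sep : separating E F.

Lemma lifting_walk j n : exists N, forall x x' y,
  agree N (F x) (F x') -> walk E j x y ->
  exists2 y', walk E j x' y' & agree n (F y) (F y').
Proof.
elim: j => [|j [N NP]]; first by exists n => x x' y xx' /= <-; exists x'.
have [M MP] := E_lift N; exists M => x x' y xx' [z xz zy].
have [z' xz' zz'] := MP _ _ _ xx' xz.
have [y' zy' yy'] := NP _ _ _ zz' zy.
by exists y' => //; exists z'.
Qed.

Lemma lifting_gball r n : exists N, forall x x' y,
  agree N (F x) (F x') -> gball E x r y ->
  exists2 y', gball E x' r y' & agree n (F y) (F y').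
Proof.
have /choice[N NP] := lifting_walk ^~ n.
exists (\max_(j < r.+1) N j) => x x' y xx' [j jr xy].
have jr' : (j < r.+1)%N by [].
have [|y' xy' yy'] := NP j x x' y _ xy; last by exists y' => //; exists j.
apply: agreeW xx'; exact: (@leq_bigmax _ (fun j : 'I_r.+1 => N j) (Ordinal jr')).
Qed.

(** Lifting in both directions finds for each point of one ball a match in the other; separation
    makes matches unique, so the matching is a bijection that respects edges. *)
Lemma local_iso r n : exists N, forall x x', agree N (F x) (F x') ->
  exists2 phi : T -> T, nbhd_iso E r x x' phi &
    forall u, gball E x r u -> agree n (F u) (F (phi u)).
Proof.
(* Uniqueness will compare a point of the ball of radius [r.+1] with one of the ball of radius [r];
   their distance is at most [r.+1 + r]. *)
have [m mP] := E_sep (r.+1 + r); have [N1 N1P] := E_lift m.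
pose n0 := maxn n (maxn m N1).
have n0n : (n <= n0)%N by exact: leq_maxl.
have n0m : (m <= n0)%N by rewrite /n0 !leq_max leqnn orbT.
have n0N1 : (N1 <= n0)%N by rewrite /n0 !leq_max leqnn !orbT.
have [N NP] := lifting_gball r n0.
exists (maxn N n0) => x x' xx'.
have NPx := NP x x' ^~ (agreeW (leq_maxl _ _) xx').
have NPx' := NP x' x ^~ (agreeW (leq_maxl _ _) (agree_sym xx')).
have uniq_near z u v : gball E z r.+1 u -> gball E z r v ->
    agree m (F u) (F v) -> u = v.
  move=> zu zv uv; apply: mP => //; apply: gball_trans zv.
  exact: gball_sym.
have /choice[phi phiP] : forall u, exists u', gball E x r u ->
    gball E x' r u' /\ agree n0 (F u) (F u').
  move=> u; have [xu|nxu] := pselect (gball E x r u); last by exists x'.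
  by have [u' ? ?] := NPx _ xu; exists u'.
have phi_ball u : gball E x r u -> gball E x' r (phi u) by move=> /phiP[].
have phi_agree u : gball E x r u -> agree n0 (F u) (F (phi u)) by move=> /phiP[].
have phi_eq u v : gball E x r u -> gball E x' r.+1 v -> agree m (F u) (F v) ->
    phi u = v.
  move=> xu xv uv; apply/esym/(uniq_near x') => //; first exact: phi_ball.
  apply: agree_trans (agree_sym uv) _; apply: agreeW n0m _; exact: phi_agree.
exists phi; last by move=> u xu; apply: agreeW n0n _; exact: phi_agree.
split; first split.
- by move=> u; exact: phi_ball.
- move=> u v; rewrite !inE => xu xv uv; apply: (uniq_near x) => //.
    exact: gballW xu.
  apply: (agreeW n0m); apply: agree_trans (phi_agree u xu) _.
  by rewrite uv; apply: agree_sym; exact: phi_agree.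
- move=> v xv; have [u xu uv] := NPx' _ xv; exists u => //.
  apply: phi_eq => //; first exact: gballW xv.
  by apply: agreeW n0m _; exact: agree_sym.
(* The lift of the edge [(u, v)] to [phi u] ends within [r.+1] of [x'] and near [v], so it ends at
   [phi v]; the converse is symmetric. *)
- move=> u v xu xv; split=> uv.
    have [v' uv' vv'] := N1P _ _ _ (agreeW n0N1 (phi_agree u xu)) uv.
    rewrite (phi_eq v v')//; rewrite -addn1.
    by apply: gball_trans (phi_ball _ xu) _; exact: gball1.
  have [v' uv' vv'] := N1P _ _ _ (agreeW n0N1 (agree_sym (phi_agree u xu))) uv.
  suff <- : v' = v by [].
  apply: (uniq_near x) => //.
    by rewrite -addn1; apply: gball_trans xu _; exact: gball1.
  apply: agree_sym; apply: agree_trans vv'.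
  by apply: agreeW n0m _; exact: phi_agree.
- apply: phi_eq; [exact: gball_refl|exact: gball_refl|].
  by apply: agreeW xx'; rewrite leq_max n0m orbT.
Qed.

End local_isomorphisms.

(** * The closure of the graph in the space of codes *)

Section completion.
Variables (T T' : choiceType) (E : set (T * T)) (D : nat).
Variables (F : T -> nat -> bool) (c : T' -> nat -> bool) (iota : T -> T').
Hypothesis E_irrefl : forall x, ~ E (x, x).
Hypothesis E_sym : forall x y, E (x, y) -> E (y, x).
Hypothesis ED : finite_degree D E.
Hypothesis E_lift : lifting E F.
Hypothesis E_sep : separating E F.
Hypothesis c_inj : injective c.
Hypothesis c_dense : forall y n, exists x, agree n (c y) (F x).
Hypothesis c_complete :
  forall z, (forall n, exists x, agree n z (F x)) -> exists y, c y = z.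
Hypothesis iotaE : forall x, c (iota x) = F x.

Definition edge_closure : set (T' * T') := [set p | forall n, exists x y,
  [/\ E (x, y), agree n (c p.1) (F x) & agree n (c p.2) (F y)]].

Local Notation E' := edge_closure.

Lemma edge_closure_sym y z : E' (y, z) -> E' (z, y).
Proof.
by move=> yz n; have [x [u [xu yx zu]]] := yz n; exists u, x; split=> //; exact: E_sym.
Qed.

Lemma edge_closure_irrefl y : ~ E' (y, y).
Proof.
have [m mP] := E_sep 1; move=> /(_ m)[x [u [xu yx yu]]].
apply: (@E_irrefl x); rewrite {2}(mP _ _ (gball1 xu))//.
exact: agree_trans (agree_sym yx) yu.
Qed.

Lemma edge_closure_iota x y : E (x, y) -> E' (iota x, iota y).
Proof. by move=> xy n; exists x, y; rewrite /= !iotaE. Qed.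

(** Edges of [E] near [(iota x, z)] lift to edges at [x] itself, with ends near [z] to any
    precision. As [x] has finitely many neighbors, one of them has the code of [z]. Hence the image
    of [iota] is a union of components. *)
Lemma edge_closure_component x z :
  E' (iota x, z) -> exists2 y, E (x, y) & z = iota y.
Proof.
move=> xz; have [l _ lE] := ED x.
have near n : exists u, [/\ u \in l, E (x, u) & agree n (c z) (F u)].
  have [N NP] := E_lift n.
  have [x1 [u [x1u /= xx1 zu]]] := xz (maxn N n).
  have [|v xv uv] := NP x1 x u _ x1u.
    by rewrite -(iotaE x); apply: agree_sym; apply: agreeW xx1; exact: leq_maxl.
  exists v; split=> //; first exact: lE.
  by apply: agree_trans uv; apply: agreeW zu; exact: leq_maxr.
(* Pigeonhole along the list of candidates: a neighbor that fails at some precision is discarded. *)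
have [u xu zu] : exists2 u, E (x, u) & forall n, agree n (c z) (F u).
  elim: l near {lE} => [|v l IH] near; first by have [u []] := near 0%N.
  have [[xv zv]|nv] := pselect (E (x, v) /\ forall n, agree n (c z) (F v)).
    by exists v.
  have [[n nzv]|all] := pselect (exists n, ~ (E (x, v) /\ agree n (c z) (F v))).
    apply: IH => k; have [u [ul xu zu]] := near (maxn n k).
    exists u; split=> //; last by apply: agreeW zu; exact: leq_maxr.
    move: ul; rewrite inE => /orP[/eqP uv|//]; exfalso; apply: nzv.
    by rewrite -uv; split=> //; apply: agreeW zu; exact: leq_maxl.
  exfalso; apply: nv; split=> [|n].
    by apply: contrapT => nE; apply: all; exists 0%N => -[].
  by apply: contrapT => nE; apply: all; exists n => -[].
exists u => //; apply: c_inj; rewrite iotaE; apply/funext => n.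
exact: (zu n.+1).
Qed.

Lemma walk_closure_component n x z :
  walk E' n (iota x) z -> exists2 y, walk E n x y & z = iota y.
Proof.
elim: n x => [|n IH] x /=; first by exists x.
move=> [_ /edge_closure_component[y xy ->] /IH[u yu zu]].
by exists u => //; exists y.
Qed.

(** Edges of [E] near [(y, z)] lift to edges near [y'] to every precision; König's lemma on the
    codes of their ends gives the limit [z']. *)
Lemma edge_closure_lift : lifting E' c.
Proof.
move=> n; have [N NP] := E_lift n; exists N => y y' z yy' yz.
have [||k|w wP] := @konig bool (fun t => exists x u, [/\ E (x, u),
    agree (size t) (c y') (F x), agree n (c z) (F u) & mkseq (F u) (size t) = t]).
- move=> s t [x [u [xu yx zu ust]]]; exists x, u; split=> //.
    by apply: agreeW yx; rewrite size_cat leq_addr.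
  by rewrite -[in RHS](take_size_cat t (erefl (size s))) -ust -map_take
    take_iota size_cat (minn_idPl (leq_addr _ _)).
- by move=> t; exists [:: true; false] => -[]; rewrite !inE.
- have [x [u [xu /= yx zu]]] := yz (maxn N n).
  have [x' yx'] := c_dense y' (maxn N k).
  have [|u' xu' uu'] := NP x x' u _ xu.
    apply: agree_trans (agree_sym (agreeW (leq_maxl N n) yx)) _.
    exact: agree_trans yy' (agreeW (leq_maxl N k) yx').
  exists (mkseq (F u') k); rewrite ?size_mkseq//.
  exists x', u'; rewrite ?size_mkseq; split=> //.
    by apply: agreeW yx'; exact: leq_maxr.
  by apply: agree_trans uu'; apply: agreeW zu; exact: leq_maxr.
- have {}wP k : exists x u, [/\ E (x, u), agree k (c y') (F x),
      agree n (c z) (F u) & agree k w (F u)].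
    have [x [u []]] := wP k; rewrite size_mkseq => xu yx zu /mkseq_agree uw.
    by exists x, u; split=> //; exact: agree_sym.
  have [z' z'w] : exists z', c z' = w.
    by apply: c_complete => k; have [x [u []]] := wP k; exists u.
  exists z'.
    by move=> k; have [x [u [xu yx _ wu]]] := wP k; exists x, u; rewrite /= z'w.
  have [x [u [_ _ zu wu]]] := wP n; rewrite z'w.
  exact: agree_trans zu (agree_sym wu).
Qed.

(** A walk from [y] to [z] lifts to a walk in [E] between points near [y] and [z], which coincide by
    separation. The precision being arbitrary, so do [y] and [z]. *)
Lemma edge_closure_sep : separating E' c.
Proof.
move=> r; have [m mP] := E_sep r; exists m => y z [j jr yz] ymz.
apply: c_inj; apply/funext => i.
pose n := maxn m i.+1.
have [N NP] := lifting_walk edge_closure_lift j n.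
have [x yx] := c_dense y (maxn N n).
have [|_ /walk_closure_component[u xu ->] zu] := NP y (iota x) z _ yz.
  by rewrite iotaE; apply: agreeW yx; exact: leq_maxl.
have {}yx := agreeW (leq_maxr N n) yx; rewrite iotaE in zu.
have xu_eq : x = u.
  apply: mP; first by exists j.
  apply: agree_trans (agree_sym (agreeW (leq_maxl _ _) yx)) _.
  exact: agree_trans ymz (agreeW (leq_maxl _ _) zu).
by rewrite (yx i) ?(zu i) ?xu_eq// leq_max ltnSn orbT.
Qed.

(** Each neighbor of [y] is near a neighbor of a point [x] of [T] close to [y]. Two neighbors of [y]
    are at distance at most [2], so at most one is near a given neighbor of [x]. *)
Lemma edge_closure_degree : finite_degree D E'.
Proof.
move=> y; have [m mP] := edge_closure_sep 2; have [N NP] := edge_closure_lift m.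
have [x yx] := c_dense y N; have [l lD lE] := ED x.
have /choice[f fP] : forall u, exists z,
    (exists2 z', E' (y, z') & agree m (c z') (F u)) ->
    E' (y, z) /\ agree m (c z) (F u).
  move=> u; have [[z ? ?]|n] := pselect (exists2 z', E' (y, z') & agree m (c z') (F u)).
    by exists z.
  by exists y.
exists (map f l) => [|z yz]; first by rewrite size_map.
have [|_ /edge_closure_component[u xu ->] zu] := NP y (iota x) z _ yz.
  by rewrite iotaE.
rewrite iotaE in zu; have [yf fu] := fP u (ex_intro2 _ _ z yz zu).
apply/mapP; exists u; first exact: lE.
apply: mP; last exact: agree_trans zu (agree_sym fu).
rewrite -[2%N]/(1 + 1)%N; apply: gball_trans (gball1 yf).
exact/gball1/edge_closure_sym.
Qed.

End completion.

(** * Closed subspaces of the Cantor space *)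

(* The parameters [R] and [k0] are phantom: they only let the metric and the
   base point be inferred from the type. *)
Definition cantor_subspace (R : realType) (K : set (nat -> bool))
  (k0 : nat -> bool) (Kk0 : K k0) : Type := {z : nat -> bool | K z}.

Section cantor_subspace.
Variables (R : realType) (K : set (nat -> bool)) (k0 : nat -> bool).
Variable Kk0 : K k0.

Local Notation X := (cantor_subspace R Kk0).
Implicit Types x y z : X.

Definition cantor_val (x : X) : cantor_seq := sval x.

Lemma cantor_val_inj : injective cantor_val.
Proof.
move=> [z Kz] [z' Kz'] /= zz'; rewrite /cantor_val/= in zz'.
by case: _ / zz' in Kz' *; congr exist; exact: Prop_irrelevance.
Qed.

HB.instance Definition _ := gen_eqMixin X.
HB.instance Definition _ := gen_choiceMixin X.
HB.instance Definition _ := isPointed.Build X (exist _ k0 Kk0).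

Let differ x y := exists n, cantor_val x n != cantor_val y n.

Definition cantor_dist (x y : X) : R :=
  if pselect (differ x y) is left xy then (ex_minn xy).+1%:R^-1 else 0.

Let cantor_distP x y :
  (x = y /\ cantor_dist x y = 0) \/
  exists m, [/\ agree m (cantor_val x) (cantor_val y),
    cantor_val x m <> cantor_val y m & cantor_dist x y = m.+1%:R^-1].
Proof.
rewrite /cantor_dist; case: pselect => [xy|nxy].
  right; case: ex_minnP => m /eqP xym mmin; exists m; split=> // i im.
  by apply/eqP; apply: contraTT im => /mmin; rewrite -leqNgt.
left; split=> //; apply: cantor_val_inj; apply/funext => n.
by apply/eqP; apply: contrapT => /negP xyn; apply: nxy; exists n.
Qed.

Lemma cantor_dist_lt x y n :
  cantor_dist x y < n.+1%:R^-1 <-> agree n.+1 (cantor_val x) (cantor_val y).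
Proof.
have [[-> ->]|[m [xym nxym ->]]] := cantor_distP x y; first by rewrite invr_gt0.
rewrite ltf_pV2 ?posrE// ltr_nat ltnS; split=> [nm|xyn]; first exact: agreeW xym.
by rewrite ltnNge; apply/negP => mn; apply: nxym; apply: xyn.
Qed.

Let cantor_dist_ge0 x y : 0 <= cantor_dist x y.
Proof.
by have [[-> ->]|[m [_ _ ->]]] := cantor_distP x y; rewrite ?invr_ge0.
Qed.

Let cantor_distxx x : cantor_dist x x = 0.
Proof. by have [[]|[m []]] := cantor_distP x x. Qed.

Let cantor_dist0 x y : cantor_dist x y = 0 -> x = y.
Proof.
have [[//]|[m [_ _ ->]]] := cantor_distP x y.
by move/eqP; rewrite invr_eq0 pnatr_eq0.
Qed.

Let cantor_dist_le x y m : cantor_val x m <> cantor_val y m ->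
  m.+1%:R^-1 <= cantor_dist x y.
Proof. by move=> xym; rewrite leNgt; apply/negP => /cantor_dist_lt/(_ m (ltnSn m)). Qed.

Let cantor_dist_sym x y : cantor_dist x y = cantor_dist y x.
Proof.
apply/eqP; rewrite eq_le; apply/andP; split.
  have [[_ ->]//|[m [_ xym ->]]] := cantor_distP x y.
  by apply: cantor_dist_le => /esym.
have [[_ ->]//|[m [_ xym ->]]] := cantor_distP y x.
by apply: cantor_dist_le => /esym.
Qed.

(** At the first place where [x] and [z] differ, [y] differs from one of them. *)
Let cantor_dist_triangle y x z :
  cantor_dist x z <= cantor_dist x y + cantor_dist y z.
Proof.
have [[_ ->]|[m [_ xzm ->]]] := cantor_distP x z; first by rewrite addr_ge0 ?cantor_dist_ge0.
have [xym|/eqP/cantor_dist_le xym] := eqVneq (cantor_val x m) (cantor_val y m).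
  rewrite (le_trans (cantor_dist_le (x := y) (y := z) (m := m) _)) ?lerDr//.
  by rewrite -xym.
by rewrite (le_trans xym)// lerDl.
Qed.

HB.instance Definition _ := isMetric.Build R X
  cantor_distxx cantor_dist0 cantor_dist_sym cantor_dist_triangle.

HB.instance Definition _ := @isMeasurable.Build (sigma_display (@open X)) X
  <<s @open X >> (@sigma_algebra0 _ setT (@open X)) (@sigma_algebraC _ (@open X))
  (@sigma_algebra_bigcup _ setT (@open X)).

Lemma cantor_mdist_lt x y n :
  mdist x y < n.+1%:R^-1 <-> agree n.+1 (cantor_val x) (cantor_val y).
Proof. exact: cantor_dist_lt. Qed.

Lemma cantor_openP (U : set X) : open U <->
  forall x, U x -> exists n, forall y, agree n (cantor_val x) (cantor_val y) -> U y.
Proof.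
split=> [/metric_openP Uo x /Uo[e /ltr_add_invr[n]]|Uo].
  rewrite add0r => ne eU; exists n.+1 => y /cantor_mdist_lt xy.
  by apply: eU; exact: lt_trans ne.
apply/metric_openP => x /Uo[n nU]; exists n.+1%:R^-1; first by rewrite invr_gt0.
by move=> y /cantor_mdist_lt xy; apply: nU; exact: agreeW xy.
Qed.

Lemma cantor_borel_metric : borel_metric (X : measurableMetricType _ R).
Proof. by []. Qed.

Lemma measurable_cantor_val : measurable_fun setT cantor_val.
Proof.
apply/measurable_fun_cantor => n; apply: sub_sigma_algebra; apply/cantor_openP.
by move=> x /= xn; exists n.+1 => y <-.
Qed.

Lemma measurable_fun_cantor_subspace d (T : measurableType d) (f : T -> X) :
  measurable_fun setT (cantor_val \o f) -> measurable_fun setT f.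
Proof.
move=> mf; apply: (@measurability _ _ T X setT f (@open X)) => //.
move=> _ [U /cantor_openP Uo <-]; rewrite setTI.
rewrite (_ : _ @^-1` _ = [set t | exists q : seq bool,
    (forall y, mkseq (cantor_val y) (size q) = q -> U y) /\
    mkseq (cantor_val (f t)) (size q) = q]).
  apply: measurable_prop_exists => q; apply: measurable_prop_and.
    exact: measurable_prop_cst.
  exact: (measurable_preimage mf (measurable_mkseq (size q) q)).
apply/seteqP; split=> t /=; last by move=> [q [qU fq]]; exact: qU.
move=> /Uo[n nU]; exists (mkseq (cantor_val (f t)) n).
rewrite size_mkseq; split=> // y /mkseq_agree yf.
by apply: nU; exact: agree_sym.
Qed.

Lemma cantor_separable : separable X.
Proof.
have /choice[s sP] : forall q : seq bool, exists x : X,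
    (exists y, mkseq (cantor_val y) (size q) = q) ->
    mkseq (cantor_val x) (size q) = q.
  move=> q; have [[y yq]|nq] := pselect (exists y, mkseq (cantor_val y) (size q) = q).
    by exists y.
  by exists point.
exists (range s) => [|U [x Ux] /cantor_openP Uo].
  by apply: sub_countable (card_image_le s setT) _; exact: countableP.
have [n nU] := Uo x Ux; exists (s (mkseq (cantor_val x) n)).
split; last by exists (mkseq (cantor_val x) n).
apply: nU; apply/agree_sym/mkseq_agree.
have := sP (mkseq (cantor_val x) n); rewrite size_mkseq; apply.
by exists x.
Qed.

Hypothesis K_closed : forall z : nat -> bool, (forall n, exists2 z', agree n z z' & K z') -> K z.

Lemma cantor_compact : compact [set: X].
Proof.
rewrite compact_ultra => F FU _.
(* Each bit of the limit is the value shared by a set of points in the ultrafilter. *)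
pose z n := `[< F [set x | cantor_val x n = true] >].
have Fz n : F [set x | agree n z (cantor_val x)].
  elim: n => [|n IH]; first by apply: filterS (@filterT _ F _).
  have Fn : F [set x | z n = cantor_val x n].
    rewrite /z; case: asboolP => [|nF]; first by apply: filterS => x.
    have [//|] := in_ultra_setVsetC [set x | cantor_val x n = true] FU.
    by apply: filterS => x /=; case: (cantor_val x n).
  apply: filterS2 IH Fn => x xn xSn i.
  by rewrite ltnS leq_eqVlt => /orP[/eqP->//|/xn].
have Kz : K z.
  apply: K_closed => n; have [x zx] := filter_ex (Fz n).
  by exists (cantor_val x) => //; exact: svalP.
exists (exist _ z Kz : X); split=> // U.
move=> /nbhs_interior/nbhs_singleton Uz.
have [Uo _] := cantor_openP U°.
have [n nU] := Uo (@open_interior _ U) _ Uz; apply: filterS (Fz n) => x zx.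
by apply: interior_subset; apply: nU.
Qed.

Lemma cantor_complete : complete_metric X.
Proof.
move=> F FF Fc; exists (lim F).
exact: (compact_cauchy_cvg FF Fc filterT cantor_compact).
Qed.

Lemma cantor_standard_borel : standard_borel R X.
Proof.
exists X; split; [exact: cantor_complete|exact: cantor_separable|].
by exists id => [|A]; [exists id|rewrite image_id].
Qed.

End cantor_subspace.

(** * Compact graphings *)

Lemma counting_image (R : realType) (T T' : choiceType) (f : T -> T')
    (A : set T) : {in A &, injective f} ->
  counting (f @` A) = counting A :> \bar R.
Proof.
move=> finj; have fA := inj_card_eq finj.
rewrite /counting; have [/finite_setP[n An]|Ainf] := pselect (finite_set A).
  have fAn : (f @` A #= `I_n)%card by exact: card_eq_trans An.
  rewrite !asboolT; [|by apply/finite_setP; exists n..].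
  by rewrite (card_fset_set An) (card_fset_set fAn).
rewrite !asboolF//; apply: contra_not Ainf => /finite_setP[n fAn].
by apply/finite_setP; exists n; apply: card_eq_trans fAn; rewrite card_eq_sym.
Qed.

Lemma finite_degreeP (R : realType) (T : choiceType) D (E : set (T * T)) :
  finite_degree D E <-> forall x, (deg R E setT x <= D%:R%:E)%E.
Proof.
split=> ED x.
  have [l lD lE] := ED x; rewrite /deg /counting.
  have Xl : [set y | [set: T] y /\ E (x, y)] `<=` [set` l] by move=> y [_ /lE].
  have Xfin := sub_finite_set Xl (finite_seq l).
  rewrite asboolT// lee_fin ler_nat (leq_trans _ lD)//.
  by apply: uniq_leq_size => // y; rewrite in_fset_set// inE => /Xl.
have := ED x; rewrite /deg /counting.
case: asboolP => [Xfin|//]; rewrite lee_fin ler_nat => XD.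
exists (fset_set [set y | [set: T] y /\ E (x, y)]) => // y xy.
by rewrite in_fset_set// inE.
Qed.

(** Prefixes of a fixed length [m] tell the neighbors of a point apart, so the degree counts the set
    [Q x] of prefixes of its neighbors in [B]. This set takes finitely many values, each on a
    measurable set. *)
Lemma measurable_deg (R : realType) d (T : measurableType d)
    (c : T -> cantor_seq) (E : set (T * T)) (B : set T) :
  measurable_fun setT c -> (forall x y, E (x, y) -> E (y, x)) ->
  separating E c ->
  (forall A, measurable A -> measurable (neighbors E A)) ->
  measurable B -> measurable_fun [set: T] (deg R E B : T -> \bar R).
Proof.
move=> mc E_sym E_sep mN mB; have [m mP] := E_sep 2.
pose pre (y : T) : m.-tuple bool := Tuple (introT eqP (size_mkseq (c y) m)).
pose Q x := pre @` [set y | B y /\ E (x, y)].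
have preP y q : pre y = q <-> mkseq (c y) m = q.
  by split=> [<-//|yq]; apply/val_inj.
have degQ x : deg R E B x = counting (Q x).
  rewrite /Q counting_image// => y z; rewrite !inE => -[_ xy] [_ xz] yz.
  apply: mP; last by apply/mkseq_agree; exact: (congr1 val yz).
  by apply: (@gball_trans _ _ _ x _ 1 1); apply: gball1 => //; exact: E_sym.
have mQ q : measurable [set x | Q x q].
  rewrite (_ : [set x | _] = neighbors E [set y | B y /\ mkseq (c y) m = q]).
    apply: mN; apply: measurable_prop_and => //.
    exact: (measurable_preimage mc (measurable_mkseq m q)).
  apply/seteqP; split=> x.
    by move=> [y [By xy] /preP yq]; exists y.
  by move=> [y [[By /preP yq] xy]]; exists y.
move=> _ Y _; rewrite setTI.
rewrite (_ : _ @^-1` Y = [set x | exists S : {set m.-tuple bool},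
    Y (counting [set q | q \in S]) /\
    forall q, `[< Q x q >] = (q \in S)]).
  apply: measurable_prop_exists => S; apply: measurable_prop_and.
    exact: measurable_prop_cst.
  apply: measurable_prop_forall => q; case: (q \in S).
    rewrite (_ : [set x | _] = [set x | Q x q]) //.
    by apply/seteqP; split=> x /asboolP.
  rewrite (_ : [set x | _] = [set x | ~ Q x q]); first exact: measurable_prop_not.
  by apply/seteqP; split=> x; [move=> /negbT/asboolPn|move=> /= /asboolPn/negbTE].
apply/seteqP; split=> x; rewrite /= degQ.
  move=> Yx; exists [set q | `[< Q x q >]]%SET.
  split=> [|q]; last by rewrite inE.
  rewrite (_ : [set q | _]%classic = Q x)//.
  by apply/seteqP; split=> q; rewrite /= inE => /asboolP.
move=> [S [YS SP]]; rewrite (_ : Q x = [set q | q \in S])//.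
by apply/seteqP; split=> q; rewrite /= -SP => /asboolP.
Qed.

Theorem theorem1 (R : realType) (D : nat) (D_gt0 : (0 < D)%N)
    (d : measure_display) (T : measurableType d) (G : graphing R D T) :
  exists (d' : measure_display) (T' : measurableMetricType d' R)
    (G' : graphing R D T'),
    compact_graphing G' /\ full_subgraphing G G'.
Proof.
case: G => E P T_standard mE E_irrefl E_sym E_deg balanced.
have E_fin : finite_degree D E by apply/finite_degreeP; exact: E_deg.
have [h [g hg]] := standard_borel_coding T_standard.
have [F [g' [[mF mg' FK] E_lift E_sep]]] :=
  lifting_separating_coding hg mE E_sym E_fin.
pose K (z : nat -> bool) := forall n, exists x, agree n z (F x).
have KF x : K (F x) by move=> n; exists x.
have K_closed (z : nat -> bool) : (forall n, exists2 z', agree n z z' & K z') -> K z.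
  move=> zK n; have [z' zz' /(_ n)[x z'x]] := zK n.
  by exists x; exact: agree_trans z'x.
pose T' : measurableMetricType _ R := cantor_subspace R (KF point).
pose c : T' -> cantor_seq := @cantor_val R K (F point) (KF point).
pose iota (x : T) : T' := exist K (F x) (KF x).
have iotaE x : c (iota x) = F x by [].
have c_inj : injective c by exact: cantor_val_inj.
have c_dense y n : exists x, agree n (c y) (F x) by exact: (svalP y).
have c_complete (z : nat -> bool) : (forall n, exists x, agree n z (F x)) -> exists y, c y = z.
  by move=> zK; exists (exist K z zK).
have mc : measurable_fun [set: T'] c := @measurable_cantor_val R K (F point) (KF point).
pose E' : set (T' * T') := edge_closure E F c.
have E'_sym y z : E' (y, z) -> E' (z, y) by exact: edge_closure_sym.
have E'_irrefl y : ~ E' (y, y) by exact: edge_closure_irrefl.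
have E'_iota x y : E (x, y) -> E' (iota x, iota y) by exact: edge_closure_iota.
have E'_component x z : E' (iota x, z) -> exists2 y, E (x, y) & z = iota y.
  exact: edge_closure_component.
have E'_lift : lifting E' c by apply: edge_closure_lift.
have E'_sep : separating E' c by apply: edge_closure_sep E_fin E_lift E_sep _ _ _ iotaE.
have E'_deg : finite_degree D E'.
  by apply: edge_closure_degree E_sym E_fin E_lift E_sep _ _ _ iotaE.
have T'_standard : standard_borel R T' by exact: cantor_standard_borel.
have mE' : measurable E'.
  (* A countable intersection of countable unions of products of cylinders. *)
  rewrite (_ : E' = [set p | forall n, exists q1 q2 : seq bool,
      (exists x y, [/\ E (x, y), mkseq (F x) n = q1 & mkseq (F y) n = q2]) /\
      (mkseq (c p.1) n = q1 /\ mkseq (c p.2) n = q2)]).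
    apply: measurable_prop_forall => n; do 2 apply: measurable_prop_exists => ?.
    apply: measurable_prop_and; first exact: measurable_prop_cst.
    apply: measurable_prop_and.
      exact: (measurable_preimage (measurableT_comp mc measurable_fst) (measurable_mkseq _ _)).
    exact: (measurable_preimage (measurableT_comp mc measurable_snd) (measurable_mkseq _ _)).
  apply/seteqP; split=> p pE n; have := pE n.
    move=> [x [y [xy /mkseq_agree px /mkseq_agree py]]].
    by exists (mkseq (c p.1) n), (mkseq (c p.2) n); split=> //; exists x, y.
  move=> [q1 [q2 [[x [y [xy <- <-]]] [/mkseq_agree px /mkseq_agree py]]]].
  by exists x, y.
have [h' [g'' hg']] := standard_borel_coding T'_standard.
have mN (A : set T') : measurable A -> measurable (neighbors E' A).
  by apply: measurable_neighbors hg' mE' _; exact: finite_bounded_degree E'_deg.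
have miota : measurable_fun setT iota by apply: measurable_fun_cantor_subspace.
pose iotaM : {mfun T >-> T'} := HB.pack iota (isMeasurableFun.Build _ _ _ _ _ miota).
(* The image measure, which vanishes outside the range of [iota]. *)
pose P' : probability T' R := distribution P iotaM.
have iota_inj : injective iota by move=> x y /(congr1 c); exact: (can_inj FK).
have deg_iota (B : set T') : deg R E' B \o iota = deg R E (iota @^-1` B).
  apply/funext => x; rewrite /deg /= -(@counting_image _ _ _ iota); last first.
    by move=> y z _ _; exact: iota_inj.
  congr counting; apply/seteqP; split=> z /=.
    by move=> [Bz /E'_component[y xy zy]]; exists y; rewrite -?zy.
  by move=> [y [By xy] <-]; split=> //; exact: E'_iota.
(* Change of variables: along [iota], degrees in [E'] are degrees in [E], so the balance of [E]
   carries over. *)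
have integral_iota (A B : set T') : measurable A -> measurable B ->
    (\int[P']_(x in A) deg R E' B x =
     \int[P]_(x in iota @^-1` A) deg R E (iota @^-1` B) x)%E.
  move=> mA mB; rewrite -deg_iota; apply: ge0_integral_pushforward => //.
    by apply: measurable_funTS; exact: measurable_deg mc E'_sym E'_sep mN mB.
have deg_le' x : (deg R E' setT x <= D%:R%:E)%E by move: x; exact/finite_degreeP.
have balanced' (A B : set T') : measurable A -> measurable B ->
    (\int[P']_(x in A) deg R E' B x = \int[P']_(x in B) deg R E' A x)%E.
  move=> mA mB; rewrite !integral_iota//.
  by apply: balanced; exact: measurable_preimage.
pose G' : graphing R D T' :=
  Graphing T'_standard mE' E'_irrefl E'_sym deg_le' balanced'.
exists _, T', G'; split.
  split.
  - exact: cantor_borel_metric.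
  - exact: cantor_compact.
  (* A non-edge is recognized at some precision [n], and agreement on [n] bits defines a
     neighborhood. *)
  - rewrite -openC openE => -[y z] nyz.
    have [n nP] : exists n, ~ exists x u, [/\ E (x, u), agree n (c y) (F x) &
        agree n (c z) (F u)] by exact/existsNP.
    have ball_nbhs (w : T') : nbhs w [set w' | agree n (c w) (c w')].
      apply: open_nbhs_nbhs; split=> //; apply/cantor_openP => w' ww'.
      by exists n => w''; exact: agree_trans.
    exists ([set y' | agree n (c y) (c y')], [set z' | agree n (c z) (c z')]).
      by split=> /=; exact: ball_nbhs.
    move=> [y' z'] [/= yy' zz'] /(_ n)[x [u [xu y'x z'u]]].
    by apply: nP; exists x, u; split=> //; [exact: agree_trans y'x|exact: agree_trans z'u].
  - move=> eps r eps0.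
    have [n] := ltr_add_invr eps0; rewrite add0r => neps.
    have [N NP] := local_iso E'_sym E'_lift E'_sep r n.+1.
    (* A distance of at most this bound is strictly below [N.+1%:R^-1], as the strict criterion of
       [cantor_mdist_lt] requires. *)
    exists N.+2%:R^-1; first by rewrite invr_gt0.
    move=> y y' yy'; have [|phi phi_iso phi_near] := NP y y'.
      apply: (@agreeW _ _ N.+1) => //; apply/cantor_mdist_lt.
      by apply: le_lt_trans yy' _; rewrite ltf_pV2 ?posrE// ltr_nat.
    exists phi => //; rewrite /iso_dist big_seq; apply: bigmax_le; first exact: ltW.
    move=> z zy; apply: ltW; apply: lt_trans neps; apply/cantor_mdist_lt.
    apply: phi_near; have [M MP] := finite_gball r E'_deg.
    have [l _ lP] := MP y.
    have yfin : finite_set (gball E' y r).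
      by apply: sub_finite_set (finite_seq l) => u /lP.
    by move: zy; rewrite in_fset_set// inE.
exists iota; split=> //; split.
- exists (range iota); apply/seteqP; split=> z.
    by move=> [x _ <-]; exists (iota x) => //; exists 0%N.
  move=> [_ [x _ <-] [n /(walk_closure_component E_fin E_lift c_inj iotaE)]].
  by move=> [y _ ->]; exists y.
- move=> x y; split=> [|/E'_component[y' xy' /iota_inj ->]//]; exact: E'_iota.
- rewrite (_ : range iota = [set z | F (g' (c z)) = c z]).
    apply: measurable_eq_cantor => //; apply: measurableT_comp => //.
    exact: measurableT_comp.
  apply/seteqP; split=> z /=; first by move=> [x _ <-]; rewrite iotaE FK.
  by move=> zE; exists (g' (c z)) => //; apply: c_inj.
- move=> A; split=> [mA|[B mB ->]]; last exact: measurable_preimage.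
  (* Decoding by [g'] pulls [A] back to a measurable subset of [T'] whose trace is [A]. *)
  exists (c @^-1` (g' @^-1` A)).
    by apply: (measurable_preimage mc); exact: measurable_preimage.
  by apply/seteqP; split=> x; rewrite /= FK.
- by [].
Qed.
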